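(* Suppose that $$\sqrt{\mathbb V_{\boldsymbol\gamma}[\ell(\boldsymbol x,\tilde{\boldsymbol\xi})]}\ge\frac{C_\lambda}{\sqrt{nh_n^pg(\boldsymbol\gamma)}}+\tau+\sqrt{\frac{\log\left(\frac{|\mathcal X_\eta|}{\delta}\right)+\log(1+2/\tau)}{nh_n^pg(\boldsymbol\gamma)(1+o(1))}}+2M\eta\qquad\forall\boldsymbol x\in\mathcal X,$$ for some constants $C_\lambda,\tau,\eta>0$, $\delta\in(0,1)$, and $|\mathcal X_\eta|=O(1)(D/\eta)^d$. Then, with probability at least $1-\delta$, $$\max_{\mathbb P\in\mathcal P_\lambda(\hat{\mathbb P}_{\boldsymbol\gamma})}\mathbb E_{\mathbb P}[\ell(\boldsymbol x,\tilde{\boldsymbol\xi})]=\hat{\mathbb E}_{\boldsymbol\gamma}[\ell(\boldsymbol x,\tilde{\boldsymbol\xi})]+\lambda\sqrt{\hat{\mathbb V}_{\boldsymbol\gamma}[\ell(\boldsymbol x,\tilde{\boldsymbol\xi})]}\qquad\forall\boldsymbol x\in\mathcal X,$$ where the regularization parameter is set to $\lambda=C_\lambda/\sqrt{nh_n^pg(\boldsymbol\gamma)}$ and the ambiguity set is $$\mathcal P_\lambda(\hat{\mathbb P}_{\boldsymbol\gamma})=\left\{\mathbb P=\sum_{i=1}^nw_i\delta_{\boldsymbol\xi^i}\ :\ \sum_{i=1}^n\frac{(w_i-\overline w_i)^2}{\overline w_i}\le\frac{\lambda^2}{2},\ \boldsymbol w\in\Delta^n\right\}.$$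
   Context: Let $(\tilde{\boldsymbol\gamma},\tilde{\boldsymbol\xi})$ be a random vector in $\mathbb R^p\times\mathbb R^q$ with joint density $f(\boldsymbol\gamma,\boldsymbol\xi)$, and let $f_{\tilde{\boldsymbol\gamma}}$ be the marginal density of $\tilde{\boldsymbol\gamma}$ (the side information). The historical data $(\boldsymbol\gamma^1,\boldsymbol\xi^1),\dots,(\boldsymbol\gamma^n,\boldsymbol\xi^n)$ are i.i.d. copies of $(\tilde{\boldsymbol\gamma},\tilde{\boldsymbol\xi})$. A side information vector $\boldsymbol\gamma\in\mathbb R^p$ is fixed. $\mathcal X\subset\mathbb R^d$ is the feasible set and $\ell(\boldsymbol x,\boldsymbol\xi)$ the loss function. Write $\mathbb E_{\boldsymbol\gamma}[\cdot]=\mathbb E[\cdot\mid\tilde{\boldsymbol\gamma}=\boldsymbol\gamma]$ and $\mathbb V_{\boldsymbol\gamma}[\cdot]=\mathbb V[\cdot\mid\tilde{\boldsymbol\gamma}=\boldsymbol\gamma]$ for the conditional expectation and variance. The kernel is $\mathcal K(\boldsymbol\theta)=\frac1Z\exp(-\|\boldsymbol\theta\|_2)$ with $Z=\int_{\mathbb R^p}\exp(-\|\boldsymbol\theta\|_2)\,d\boldsymbol\theta$, $h_n>0$ is the bandwidth, and $\overline w_i=\mathcal K\big(\frac{\boldsymbol\gamma-\boldsymbol\gamma^i}{h_n}\big)/\sum_{j=1}^n\mathcal K\big(\frac{\boldsymbol\gamma-\boldsymbol\gamma^j}{h_n}\big)$ are the Nadaraya-Watson weights. Then $\hat{\mathbb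 E}_{\boldsymbol\gamma}[\ell(\boldsymbol x,\tilde{\boldsymbol\xi})]=\sum_{i=1}^n\overline w_i\ell(\boldsymbol x,\boldsymbol\xi^i)$, $\hat{\mathbb V}_{\boldsymbol\gamma}[\ell(\boldsymbol x,\tilde{\boldsymbol\xi})]=\sum_{i=1}^n\overline w_i\big(\ell(\boldsymbol x,\boldsymbol\xi^i)-\hat{\mathbb E}_{\boldsymbol\gamma}[\ell(\boldsymbol x,\tilde{\boldsymbol\xi})]\big)^2$, and $\hat{\mathbb P}_{\boldsymbol\gamma}=\sum_{i=1}^n\overline w_i\delta_{\boldsymbol\xi^i}$ is the empirical conditional distribution ($\delta_{\boldsymbol\xi}$ is the Dirac distribution at $\boldsymbol\xi$). $\Delta^n=\{\boldsymbol w\in\mathbb R^n_+:\sum_i w_i=1\}$ is the probability simplex. The scaled marginal density is $g(\boldsymbol\gamma)=f_{\tilde{\boldsymbol\gamma}}(\boldsymbol\gamma)/\big(2\int_{\mathbb R^p}\mathcal K^2(\boldsymbol\theta)\,d\boldsymbol\theta\big)$. Standing assumptions: (A1) the support $\Xi$ of $\tilde{\boldsymbol\xi}$ is compact and $\ell(\boldsymbol x,\boldsymbol\xi)\in[0,1]$ for all $\boldsymbol x\in\mathcal X$, $\boldsymbol\xi\in\Xi$; (A2) $f(\boldsymbol\gamma,\boldsymbol\xi)$ is twice differentiable with continuous and bounded partial derivatives, and $f_{\tilde{\boldsymbol\gamma}}$ is non-zero at the given $\boldsymbol\gamma$; (A3) $h_n\to0$ and $nh_n^p\to\infty$ as $n\to\infty$.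 Moreover $\ell(\cdot,\boldsymbol\xi)$ is convex for all $\boldsymbol\xi\in\Xi$; $\mathcal X$ is bounded with finite diameter $D=\sup_{\boldsymbol x,\boldsymbol x'\in\mathcal X}\|\boldsymbol x-\boldsymbol x'\|$; and $\ell$ is $M$-Lipschitz in $\boldsymbol x$: $|\ell(\boldsymbol x,\boldsymbol\xi)-\ell(\boldsymbol x',\boldsymbol\xi)|\le M\|\boldsymbol x-\boldsymbol x'\|$ for all $\boldsymbol x,\boldsymbol x'\in\mathcal X$, $\boldsymbol\xi\in\Xi$. $\mathcal X_\eta\subset\mathcal X$ is a finite set such that every $\boldsymbol x\in\mathcal X$ is within distance $\eta$ of some point of $\mathcal X_\eta$, with $|\mathcal X_\eta|=O(1)(D/\eta)^d$. $o(1)$ denotes a quantity converging to $0$ as $n\to\infty$.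
   Formalization: The ambiguity set uses (1/2)·Σ(w_i − w̄_i)²/w̄_i ≤ λ²/2 (radius λ² for the sum) instead of the printed Σ(w_i − w̄_i)²/w̄_i ≤ λ²/2, for which the stated equality fails whenever the empirical variance is positive. *)

(* Defs.v *)
From HB Require Import structures.
From mathcomp Require Import all_boot all_order all_algebra finmap.
From mathcomp Require Import all_classical all_reals all_analysis.

Set Implicit Arguments.
Unset Strict Implicit.
Unset Printing Implicit Defensive.

Import Order.TTheory GRing.Theory Num.Def Num.Theory.
Import numFieldNormedType.Exports.

Local Open Scope classical_set_scope.
Local Open Scope ring_scope.

(** The library puts a topology on ['rV[R]_n] but no sigma-algebra.  We use the
    one generated by the coordinates (as the library does for [n.-tuple T]),
    which is the Borel sigma-algebra. *)

Section measurable_row_vector.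
Context {R : realType} (n : nat).

Let coord (i : 'I_n) (v : 'rV[R]_n) : R := v ord0 i.

Let rV_set0 : g_sigma_preimage coord set0.
Proof. exact: sigma_algebra0. Qed.

Let rV_setC A : g_sigma_preimage coord A -> g_sigma_preimage coord (~` A).
Proof. exact: sigma_algebraC. Qed.

Let rV_bigcup (F : (set 'rV[R]_n)^nat) :
  (forall i, g_sigma_preimage coord (F i)) ->
  g_sigma_preimage coord (\bigcup_i (F i)).
Proof. exact: sigma_algebra_bigcup. Qed.

HB.instance Definition _ :=
  @isMeasurable.Build default_measure_display 'rV[R]_n
    (g_sigma_preimage coord) rV_set0 rV_setC rV_bigcup.

End measurable_row_vector.

Section measurable_row_vector_theory.
Context {R : realType}.

Lemma measurable_rV_coord n (i : 'I_n) :
  measurable_fun setT (fun v : 'rV[R]_n => v ord0 i).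
Proof.
move=> _ Y mY; rewrite setTI; apply: sub_sigma_algebra => /=.
rewrite -bigcup_seq/=; exists i => /=; first by rewrite mem_index_enum.
by exists Y => //; rewrite setTI.
Qed.

Lemma measurable_fun_rV d (T : measurableType d) n (f : T -> 'rV[R]_n) :
  (forall i, measurable_fun setT (fun t => f t ord0 i)) ->
  measurable_fun setT f.
Proof.
move=> mf _ A; rewrite setTI => mA.
suff : @measurable _ 'rV[R]_n `<=` [set A | measurable (f @^-1` A)] by exact.
apply: smallest_sub; first split => /=.
- by rewrite preimage_set0; exact: measurable0.
- by move=> B mB; rewrite setTD preimage_setC; exact: measurableC.
- by move=> F mF; rewrite preimage_bigcup; exact: bigcup_measurable.
rewrite -bigcup_seq => B [i _] [Y mY <-] /=.
by rewrite setTI; have := mf i measurableT Y mY; rewrite setTI.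
Qed.

Definition rV_cons n (z : measurableTypeR R * 'rV[R]_n) : 'rV[R]_n.+1 :=
  \row_i oapp (z.2 ord0) z.1 (unlift ord0 i).

Definition rV_uncons n (v : 'rV[R]_n.+1) : measurableTypeR R * 'rV[R]_n :=
  (v ord0 ord0, \row_i v ord0 (lift ord0 i)).

Lemma rV_consK n : cancel (@rV_cons n) (@rV_uncons n).
Proof.
move=> [x v]; rewrite /rV_uncons /rV_cons; congr pair.
  by rewrite mxE unlift_none.
by apply/rowP => i; rewrite !mxE liftK.
Qed.

Lemma rV_unconsK n : cancel (@rV_uncons n) (@rV_cons n).
Proof.
move=> v; apply/rowP => i; rewrite /rV_uncons /rV_cons mxE /=.
by case: unliftP => [j ->|->] //=; rewrite mxE.
Qed.

Lemma measurable_rV_cons n : measurable_fun setT (@rV_cons n).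
Proof.
apply: measurable_fun_rV => i.
under eq_fun do rewrite mxE.
case: (unlift ord0 i) => [j|] /=; last exact: measurable_fst.
by apply: (measurableT_comp (measurable_rV_coord j)).
Qed.

Lemma measurable_rV_uncons n : measurable_fun setT (@rV_uncons n).
Proof.
apply/measurable_fun_pairP; split; first exact: measurable_rV_coord.
apply: measurable_fun_rV => i.
rewrite (_ : (fun _ => _) = fun v : 'rV[R]_n.+1 => v ord0 (lift ord0 i)).
  exact: measurable_rV_coord.
by apply/funext => v /=; rewrite mxE.
Qed.

End measurable_row_vector_theory.

(** Lebesgue measure on ['rV[R]_n], by induction on the dimension: the image of
    the product of the one-dimensional Lebesgue measure with the n-dimensional
    one under [(x, v) |-> (x, v_0, .., v_{n-1})]; see [lebesgue_rV_box]. *)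

Section lebesgue_row_vector.
Context {R : realType}.

Section step.
Context (n : nat) (mu : {sigma_finite_measure set 'rV[R]_n -> \bar R}).

Definition lebesgue_rV_step : set 'rV[R]_n.+1 -> \bar R :=
  pushforward (@lebesgue_measure R \x mu)%E (@rV_cons R n).

Let step_measurable A : measurable A -> measurable (@rV_cons R n @^-1` A).
Proof. by rewrite -[X in _ -> measurable X]setTI; exact: measurable_rV_cons. Qed.

Let step0 : lebesgue_rV_step set0 = 0%E.
Proof. by rewrite /lebesgue_rV_step /pushforward preimage_set0 measure0. Qed.

Let step_ge0 A : (0 <= lebesgue_rV_step A)%E.
Proof. by rewrite /lebesgue_rV_step /pushforward; exact: measure_ge0. Qed.

Let step_sigma_additive : semi_sigma_additive lebesgue_rV_step.
Proof.
move=> F mF tF mUF; rewrite /lebesgue_rV_step /pushforward preimage_bigcup.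
apply: measure_semi_sigma_additive.
- by move=> k; exact: step_measurable.
- apply/trivIsetP => /= i j _ _ ij; rewrite -preimage_setI.
  by move/trivIsetP : tF => /(_ _ _ _ _ ij) ->//; rewrite preimage_set0.
- by rewrite -preimage_bigcup; exact: step_measurable.
Qed.

HB.instance Definition _ :=
  isMeasure.Build _ _ _ lebesgue_rV_step step0 step_ge0 step_sigma_additive.

Let lebesgue_rV_step_sigma_finite : sigma_finite setT lebesgue_rV_step.
Proof.
have /sigma_finiteP[F [TF ndF Foo]] := sigma_finiteT (@lebesgue_measure R).
have /sigma_finiteP[G [TG ndG Goo]] := sigma_finiteT mu.
exists (fun k => @rV_uncons R n @^-1` (F k `*` G k)).
  rewrite -preimage_bigcup (_ : \bigcup_k _ = setT) ?preimage_setT//.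
  apply/seteqP; split => // -[x v] _.
  have [i _ Fx] : (\bigcup_i F i) x by rewrite -TF.
  have [j _ Gv] : (\bigcup_i G i) v by rewrite -TG.
  exists (maxn i j) => //; split => /=.
  - by move: x Fx; exact/subsetPset/ndF/leq_maxl.
  - by move: v Gv; exact/subsetPset/ndG/leq_maxr.
move=> k; have [mF Fk] := Foo k; have [mG Gk] := Goo k; split.
  rewrite -[X in measurable X]setTI; apply: measurable_rV_uncons => //.
  exact: measurableX.
rewrite /lebesgue_rV_step /pushforward -comp_preimage.
rewrite (_ : _ \o _ = id); last by apply/funext => z; exact: rV_consK.
by rewrite preimage_id product_measure1E// lte_mul_pinfty// ge0_fin_numE.
Qed.

HB.instance Definition _ :=
  @Measure_isSigmaFinite.Build _ _ _ lebesgue_rV_step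
    lebesgue_rV_step_sigma_finite.

End step.

Fixpoint lebesgue_rV (n : nat) :
    {sigma_finite_measure set 'rV[R]_n -> \bar R} :=
  if n is n'.+1 then lebesgue_rV_step (lebesgue_rV n') else \d_(0 : 'rV[R]_0).

Lemma lebesgue_rV_box n (A : 'I_n -> set R) :
  (forall i, measurable (A i)) ->
  lebesgue_rV n [set v | forall i, A i (v ord0 i)] =
  (\prod_(i < n) lebesgue_measure (A i))%E.
Proof.
elim: n A => [|n IHn] A mA.
  rewrite big_ord0 /= diracE mem_set//; by case.
have mB : measurable [set v : 'rV[R]_n | forall i, A (lift ord0 i) (v ord0 i)].
  rewrite (_ : mkset _ = \bigcap_(i in [set: 'I_n])
      ((fun v : 'rV[R]_n => v ord0 i) @^-1` A (lift ord0 i))).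
    apply: fin_bigcap_measurable => // i _.
    by rewrite -[X in measurable X]setTI; apply: measurable_rV_coord.
  by apply/seteqP; split => [v Av i _|v Av i]; [exact: Av|exact: (Av i)].
rewrite big_ord_recl -IHn; last by move=> i; exact: mA.
rewrite -product_measure1E//; last exact: mA.
rewrite /= /lebesgue_rV_step /pushforward; congr (_ _).
apply/seteqP; split => -[x v] /=.
  move=> Axv; split => [|i].
    by have := Axv ord0; rewrite mxE unlift_none.
  by have := Axv (lift ord0 i); rewrite mxE liftK.
move=> [/= Ax Av] i; rewrite mxE.
by case: unliftP => [j ->|->] //=; exact: Av.
Qed.

End lebesgue_row_vector.

Section euclidean.
Context {R : realType} {n : nat}.

(* The library norm [`|v|] on ['rV[R]_n] is the sup norm. *)
Definition enorm (v : 'rV[R]_n) : R := Num.sqrt (\sum_i v ord0 i ^+ 2).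

Definition diameter (A : set 'rV[R]_n) : R :=
  sup [set enorm (z.1 - z.2) | z in A `*` A].

End euclidean.

Section laws.
Context {R : realType}.

Definition topological_support (T : topologicalType) (mu : set T -> \bar R) :
    set T :=
  [set y | forall U, open U -> U y -> (0 < mu U)%E].

Definition mutually_independent d d' (Omega : measurableType d)
    (T : measurableType d') (P : probability Omega R) (Y : nat -> Omega -> T) :=
  forall (J : {fset nat}) (A : nat -> set T), (forall i, measurable (A i)) ->
    P (\bigcap_(i in [set` J]) (Y i @^-1` A i)) =
    (\prod_(i <- J) P (Y i @^-1` A i))%E.

Definition identically_distributed d d' (Omega : measurableType d)
    (T : measurableType d') (P : probability Omega R) (Y Y' : {RV P >-> T}) :=
  forall A, measurable A -> distribution P Y A = distribution P Y' A.

End laws.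

Section joint_density.
Context {R : realType} {p q : nat}.
Implicit Types (f : 'rV[R]_p * 'rV[R]_q -> R) (gamma : 'rV[R]_p)
  (phi : 'rV[R]_q -> R).

Definition has_density (mu : set ('rV[R]_p * 'rV[R]_q) -> \bar R) f :=
  [/\ forall z, 0 <= f z, measurable_fun setT f &
      forall A, measurable A ->
        mu A = (\int[lebesgue_rV p \x lebesgue_rV q]_(z in A) (f z)%:E)%E].

Definition std_basis (k : 'I_p + 'I_q) : 'rV[R]_p * 'rV[R]_q :=
  match k with
  | inl i => (delta_mx ord0 i, 0)
  | inr j => (0, delta_mx ord0 j)
  end.

Definition partial (k : 'I_p + 'I_q) f : 'rV[R]_p * 'rV[R]_q -> R :=
  fun z => 'D_(std_basis k) f z.

Definition continuous_bounded f :=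
  continuous f /\ exists B : R, forall z, `|f z| <= B.

(* Partial derivatives of order one and two. *)
Definition twice_differentiable_bounded f :=
  [/\ forall z, differentiable f z,
      forall k z, differentiable (partial k f) z,
      forall k, continuous_bounded (partial k f) &
      forall k l, continuous_bounded (partial l (partial k f))].

Definition marginal_density f gamma : R :=
  \int[lebesgue_rV q]_xi f (gamma, xi).

(* Conditioning on the null event [gamma~ = gamma] is understood through the
   conditional density [f (gamma, _) / marginal_density f gamma]. *)
Definition cond_expectation f gamma phi : R :=
  \int[lebesgue_rV q]_xi
    (phi xi * (f (gamma, xi) / marginal_density f gamma)).

Definition cond_variance f gamma phi : R :=
  cond_expectation f gamma
    (fun xi => (phi xi - cond_expectation f gamma phi) ^+ 2).

End joint_density.

Section nadaraya_watson.
Context {R : realType} {p q : nat}.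

Definition kernel_cst : R := \int[lebesgue_rV p]_theta expR (- enorm theta).

Definition NW_kernel (theta : 'rV[R]_p) : R :=
  kernel_cst^-1 * expR (- enorm theta).

Definition scaled_marginal_density (f : 'rV[R]_p * 'rV[R]_q -> R)
    (gamma : 'rV[R]_p) : R :=
  marginal_density f gamma /
  (2 * \int[lebesgue_rV p]_theta (NW_kernel theta ^+ 2)).

Context (gamma : 'rV[R]_p) (bw : R) {n : nat}
  (data : 'I_n -> 'rV[R]_p * 'rV[R]_q).

Definition NW_weight (i : 'I_n) : R :=
  NW_kernel (bw^-1 *: (gamma - (data i).1)) /
  \sum_j NW_kernel (bw^-1 *: (gamma - (data j).1)).

Definition NW_expectation (phi : 'rV[R]_q -> R) : R :=
  \sum_i NW_weight i * phi (data i).2.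

Definition NW_variance (phi : 'rV[R]_q -> R) : R :=
  \sum_i NW_weight i * (phi (data i).2 - NW_expectation phi) ^+ 2.

Definition simplex (w : 'I_n -> R) :=
  (forall i, 0 <= w i) /\ \sum_i w i = 1.

(* The chi-square divergence is normalised as the f-divergence of
   [t |-> (t - 1)^2 / 2].  The factor 1/2 matters: by Cauchy-Schwarz a
   reweighting with [\sum_i (w i - NW_weight i)^2 / NW_weight i <= r] shifts the
   mean of [phi] by at most [sqrt (r * NW_variance phi)], so that a penalty
   [lambda * sqrt (NW_variance phi)] is attained for [r = lambda^2], that is
   for divergence radius [lambda^2 / 2]. *)
Definition chi2_divergence (w : 'I_n -> R) : R :=
  2^-1 * \sum_i (w i - NW_weight i) ^+ 2 / NW_weight i.

Definition ambiguity_set (lambda : R) : set (probability 'rV[R]_q R) :=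
  [set Q | exists w : 'I_n -> R,
     [/\ simplex w, chi2_divergence w <= lambda ^+ 2 / 2 &
         forall A, measurable A ->
           Q A = (\sum_i (w i)%:E * \d_((data i).2) A)%E]].

End nadaraya_watson.

Definition is_max {R : realType} (A : set (\bar R)) (v : \bar R) :=
  A v /\ ubound A v.

(* Main.v *)
(** The [o(1)] term may depend on the law of the data, on the net and on all
    the constants, so finitely many sample sizes are harmless and no
    concentration inequality is needed: the weak consistency of the kernel
    estimators at [gamma] suffices.

    The density is Lipschitz in [gamma] uniformly in [xi], because its partial
    derivatives are bounded, and it vanishes off the compact support [Xi].
    After the substitution [u = gamma - h theta], the mean of
    [K ((gamma - gamma~) / h) phi(xi~)] is therefore [h ^ p] times
    [\int phi f(gamma, .) + O(h)].  As the kernel is bounded, the average of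
    [n] such terms divided by [h ^ p] has variance [O(1 / (n h ^ p))], and
    Chebyshev's inequality applies.  Hence, for [n] large, with probability at
    least [1 - delta], the empirical standard deviation at each point of the net
    is at least the true one minus [tau].  The standard deviation is
    [M]-Lipschitz in the decision, so the assumed lower bound makes the empirical
    standard deviation at least [lambda] on all of [X].

    Under that condition the Cauchy-Schwarz bound
    [\sum (w_i - wbar_i) l_i <= lambda sqrt(V)] on the chi-square ball is
    attained by [w_i = wbar_i (1 + lambda (l_i - E) / sqrt(V))]: these weights
    are nonnegative because the losses lie in [[0, 1]]. *)

From HB Require Import structures.
Require Import Defs.
From mathcomp Require Import all_boot all_order all_algebra finmap.
From mathcomp Require Import all_classical all_reals all_analysis.
From mathcomp Require Import measurable_realfun ring lra.
Set Implicit Arguments.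
Unset Strict Implicit.
Unset Printing Implicit Defensive.

Import Order.TTheory GRing.Theory Num.Theory.
Import numFieldNormedType.Exports.

Local Open Scope classical_set_scope.
Local Open Scope ring_scope.

(** * Weighted means, variances and chi-square balls *)

(** Lagrange's identity: the nonnegative double sum of [w i * w j * (a i * b j - a j * b i) ^+ 2] is
    twice the difference of the two sides. *)
Lemma weighted_cauchy_schwarz (R : realType) (I : finType) (w a b : I -> R) :
  (forall i, 0 <= w i) ->
  (\sum_i w i * (a i * b i)) ^+ 2 <=
  (\sum_i w i * a i ^+ 2) * (\sum_i w i * b i ^+ 2).
Proof.
move=> w0.
have : 0 <= \sum_i \sum_j w i * w j * (a i * b j - a j * b i) ^+ 2.
  by do 2 (apply: sumr_ge0 => ? _); rewrite mulr_ge0 ?sqr_ge0// mulr_ge0.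
rewrite (_ : \sum_i _ =
    (\sum_i w i * a i ^+ 2) * (\sum_i w i * b i ^+ 2) +
    (\sum_i w i * b i ^+ 2) * (\sum_i w i * a i ^+ 2) -
    ((\sum_i w i * (a i * b i)) * (\sum_i w i * (a i * b i)) +
     (\sum_i w i * (a i * b i)) * (\sum_i w i * (a i * b i)))); first by lra.
rewrite !big_distrlr -!big_split -sumrB; apply: eq_bigr => i _ /=.
rewrite -!big_split -sumrB /=; apply: eq_bigr => j _; ring.
Qed.

Section weighted_moments.
Context {R : realType} {I : finType}.
Implicit Types w a b : I -> R.

Definition wmean w a := \sum_i w i * a i.

Definition wvar w a := \sum_i w i * (a i - wmean w a) ^+ 2.

Lemma wvar_ge0 w a : (forall i, 0 <= w i) -> 0 <= wvar w a.
Proof. by move=> w0; apply: sumr_ge0 => i _; rewrite mulr_ge0 ?sqr_ge0. Qed.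

Lemma wvarE w a : \sum_i w i = 1 ->
  wvar w a = wmean w (fun i => a i ^+ 2) - wmean w a ^+ 2.
Proof.
move=> w1; rewrite /wvar; move mE : (wmean w a) => m.
transitivity (wmean w (fun i => a i ^+ 2) - 2 * m * wmean w a +
              m ^+ 2 * \sum_i w i).
  rewrite /wmean !mulr_sumr -sumrB -big_split.
  by apply: eq_bigr => i _ /=; ring.
by rewrite w1 mE; ring.
Qed.

Lemma wmean01 w a : (forall i, 0 <= w i) -> \sum_i w i = 1 ->
  (forall i, 0 <= a i <= 1) -> 0 <= wmean w a <= 1.
Proof.
move=> w0 w1 a01; apply/andP; split.
  by apply: sumr_ge0 => i _; rewrite mulr_ge0//; case/andP: (a01 i).
rewrite -w1; apply: ler_sum => i _; rewrite ler_piMr//.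
by case/andP: (a01 i).
Qed.

(** The weighted standard deviation is a seminorm, and that of [a - b] is at most its root mean
    square, hence at most [e]. This carries variance bounds from the net to all decisions. *)
Lemma sqrt_wvar_lipschitz w a b (e : R) : (forall i, 0 <= w i) -> \sum_i w i = 1 ->
  (forall i, `|a i - b i| <= e) -> 0 <= e ->
  Num.sqrt (wvar w a) <= Num.sqrt (wvar w b) + e.
Proof.
move=> w0 w1 abe e0.
pose c i := a i - b i.
have mc : wmean w c = wmean w a - wmean w b.
  by rewrite /wmean -sumrB; apply: eq_bigr => i _; rewrite mulrBr.
have vc : wvar w c <= e ^+ 2.
  rewrite wvarE//; apply: (@le_trans _ _ (wmean w (fun i => c i ^+ 2))).
    by rewrite lerBlDr lerDl sqr_ge0.
  rewrite -[e ^+ 2]mul1r -w1 mulr_suml; apply: ler_sum => i _.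
  rewrite ler_wpM2l// -real_normK ?num_real// ler_pXn2r ?nnegrE //. exact: abe.
have [va vb] := (wvar_ge0 a w0, wvar_ge0 b w0).
rewrite -(@ler_pXn2r _ 2)// ?nnegrE ?addr_ge0 ?sqrtr_ge0//.
(* [k] is the covariance of [b] and [c], the cross term in the expansion of the variance of
   [a = b + c]. *)
pose k := \sum_i w i * ((b i - wmean w b) * (c i - wmean w c)).
have -> : Num.sqrt (wvar w a) ^+ 2 = wvar w b + 2 * k + wvar w c.
  rewrite sqr_sqrtr// /wvar /k mulr_sumr -!big_split.
  by apply: eq_bigr => i _ /=; rewrite mc /c; ring.
have kle : k <= Num.sqrt (wvar w b) * e.
  have := weighted_cauchy_schwarz (fun i => b i - wmean w b)
    (fun i => c i - wmean w c) w0.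
  rewrite -/k -!/(wvar _ _) => k2.
  apply: (le_trans (ler_norm _)).
  rewrite -(@ler_pXn2r _ 2)// ?nnegrE ?mulr_ge0 ?sqrtr_ge0//.
  rewrite real_normK ?num_real// (le_trans k2)// exprMn sqr_sqrtr//.
  by rewrite ler_wpM2l.
by rewrite sqrrD sqr_sqrtr// -mulr_natl; lra.
Qed.

(** The shift of the mean is the [w]-inner product of the relative change [(v - w) / w] with the
    centred [a]; centring is free because [v - w] sums to 0. Cauchy-Schwarz then gives the bound. *)
Lemma chi2_ball_le w v a (lambda : R) : (forall i, 0 < w i) -> \sum_i w i = 1 ->
  \sum_i v i = 1 -> 0 <= lambda ->
  \sum_i (v i - w i) ^+ 2 / w i <= lambda ^+ 2 ->
  wmean v a <= wmean w a + lambda * Num.sqrt (wvar w a).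
Proof.
move=> w0 w1 v1 l0 chi.
have w0' i : 0 <= w i by exact: ltW.
rewrite -lerBlDl; set k := wmean v a - wmean w a.
have -> : k = \sum_i w i * (((v i - w i) / w i) * (a i - wmean w a)).
  transitivity (\sum_i (v i - w i) * a i -
                wmean w a * (\sum_i v i - \sum_i w i)).
    rewrite v1 w1 subrr mulr0 subr0 /k /wmean -sumrB.
    by apply: eq_bigr => i _; rewrite mulrBl.
  rewrite -sumrB mulr_sumr -sumrB; apply: eq_bigr => i _.
  by field; rewrite gt_eqF.
apply: (le_trans (ler_norm _)).
rewrite -(@ler_pXn2r _ 2)// ?nnegrE ?mulr_ge0 ?sqrtr_ge0//.
rewrite real_normK ?num_real// (le_trans (weighted_cauchy_schwarz _ _ w0'))//.
rewrite exprMn sqr_sqrtr ?wvar_ge0// -/(wvar w a).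
rewrite ler_wpM2r ?wvar_ge0// (le_trans _ chi)//.
rewrite le_eqVlt; apply/orP; left; apply/eqP; apply: eq_bigr => i _.
by field; rewrite gt_eqF.
Qed.

(* The Cauchy-Schwarz bound is attained by tilting [w] along the centred values
   of [a]; the condition on [lambda] is what keeps the weights nonnegative. *)
Lemma chi2_ball_attained w a (lambda : R) : (forall i, 0 < w i) -> \sum_i w i = 1 ->
  (forall i, 0 <= a i <= 1) -> 0 <= lambda <= Num.sqrt (wvar w a) ->
  exists v : I -> R, [/\ (forall i, 0 <= v i), \sum_i v i = 1,
    \sum_i (v i - w i) ^+ 2 / w i <= lambda ^+ 2 &
    wmean v a = wmean w a + lambda * Num.sqrt (wvar w a)].
Proof.
move=> w0 w1 a01 /andP[l0 ls].
have w0' i : 0 <= w i by exact: ltW.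
set s := Num.sqrt (wvar w a) in ls *.
have s2 : s ^+ 2 = wvar w a by rewrite sqr_sqrtr// wvar_ge0.
(* Without variance [lambda] is 0 and [w] itself is the witness; otherwise division by [s] is
   legitimate. *)
have [s0|sn0] := eqVneq s 0.
  have {}l0 : lambda = 0 by apply/eqP; rewrite eq_le l0 -s0 ls.
  exists w; split => //; last by rewrite s0 mulr0 addr0.
  by rewrite big1 ?l0 ?expr0n// => i _; rewrite subrr expr0n mul0r.
have sp : 0 < s by rewrite lt_def sn0 sqrtr_ge0.
pose r := lambda / s.
have r0 : 0 <= r by rewrite divr_ge0// ltW.
have r1 : r <= 1 by rewrite ler_pdivrMr// mul1r.
have center : \sum_i w i * (a i - wmean w a) = 0.
  under eq_bigr do rewrite mulrBr.
  by rewrite sumrB -mulr_suml w1 mul1r subrr.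
exists (fun i => w i * (1 + r * (a i - wmean w a))); split.
- move=> i; rewrite mulr_ge0//.
  have /andP[m0 m1] := wmean01 w0' w1 a01; have /andP[a0 _] := a01 i.
  (* Since [r] and the mean are at most 1, the tilt factor is at least [r * a i], which is
     nonnegative. *)
  have : r * wmean w a <= 1 by rewrite mulr_ile1.
  by have := mulr_ge0 r0 a0; rewrite mulrBr; lra.
- under eq_bigr do rewrite mulrDr mulr1 mulrCA.
  by rewrite big_split/= -mulr_sumr center mulr0 addr0.
- rewrite (_ : \sum_i _ = r ^+ 2 * wvar w a).
    by rewrite -s2 -exprMn divfK.
  rewrite mulr_sumr; apply: eq_bigr => i _.
  by field; rewrite gt_eqF.
- have tilt m : \sum_i w i * (1 + r * (a i - m)) * a i = \sum_i w i * a i +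
      r * (\sum_i w i * (a i - m) ^+ 2 + m * \sum_i w i * (a i - m)).
    rewrite mulr_sumr -big_split mulr_sumr -big_split.
    by apply: eq_bigr => i _ /=; ring.
  by rewrite [LHS]tilt center mulr0 addr0 -/(wvar w a) -s2 /r; congr (_ + _); field.
Qed.

End weighted_moments.

(** * Borel sets and Lebesgue measure on row vectors *)

Section rV_topology.
Context {R : realType} {n : nat}.
Implicit Types (x y : 'rV[R]_n) (U : set 'rV[R]_n).

(** Balls of the sup norm are boxes, which links the topology to the coordinate sigma-algebra and to
    [lebesgue_rV_box]. *)
Lemma rV_ballE x (e : R) : 0 < e ->
  ball x e = [set y | forall i, ball (x ord0 i) e (y ord0 i)].
Proof.
move=> e0; apply/seteqP; split => [y [_ xy] i|y xy]; first exact: xy.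
by split => // i j; rewrite (ord1 i).
Qed.

Lemma measurable_rV_box (A : 'I_n -> set R) : (forall i, measurable (A i)) ->
  measurable [set v : 'rV[R]_n | forall i, A i (v ord0 i)].
Proof.
move=> mA; rewrite (_ : mkset _ = \bigcap_(i in [set: 'I_n])
    ((fun v : 'rV[R]_n => v ord0 i) @^-1` A i)).
  apply: fin_bigcap_measurable => // i _.
  by rewrite -[X in measurable X]setTI; exact: measurable_rV_coord.
by apply/seteqP; split => [v Av i _|v Av i]; [exact: Av|exact: (Av i)].
Qed.

Lemma measurable_rV_ball x (e : R) : 0 < e -> measurable (ball x e).
Proof.
move=> e0; rewrite rV_ballE//.
by apply: (measurable_rV_box (A := fun i => ball (x ord0 i) e)) => i;
  exact: measurable_ball.
Qed.

Lemma lebesgue_rV_ball x (e : R) : 0 < e ->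
  lebesgue_rV n (ball x e) = ((e *+ 2) ^+ n)%:E.
Proof.
move=> e0; rewrite rV_ballE//.
rewrite (lebesgue_rV_box (A := fun i => ball (x ord0 i) e)); last first.
  by move=> i; exact: measurable_ball.
under eq_bigr do rewrite lebesgue_measure_ball ?ltW//.
by rewrite prodEFin big_const_ord iter_mulr_1.
Qed.

(** An open set is the countable union of the balls inside it that have a rational centre and radius
    [1 / (k + 1)]. *)
Lemma measurable_rV_open U : open U -> measurable U.
Proof.
move=> oU.
pose r k : R := k.+1%:R^-1.
pose c (z : 'rV[rat]_n) : 'rV[R]_n := map_mx ratr z.
pose D := [set z : 'rV[rat]_n * nat | ball (c z.1) (r z.2) `<=` U].
have -> : U = \bigcup_(z in D) ball (c z.1) (r z.2).
  apply/seteqP; split => [x Ux|x [z Dz] /Dz//].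
  have /nbhs_ballP[e /= e0 eU] : nbhs x U by exact: open_nbhs_nbhs.
  (* Below [e / 2], a ball of radius [r k] that contains [x] stays inside [ball x e]. *)
  have [k ke] : exists k, r k < e / 2.
    have [k] := ltr_add_invr (divr_gt0 e0 (@ltr0Sn R 1)).
    by rewrite add0r => ?; exists k.
  have r0 : 0 < r k by rewrite invr_gt0.
  have q i : {q : rat | ball (x ord0 i) (r k) (ratr q)}.
    apply: cid; have /rat_in_itvoo[q /itvP qx] : x ord0 i < x ord0 i + r k.
      by rewrite ltrDl.
    exists q; rewrite /ball/= ltr_distlC !qx.
    by rewrite (lt_trans _ (_ : x ord0 i < _)) ?qx// gtrBl.
  pose z : 'rV[rat]_n := \row_i sval (q i).
  have xz : ball x (r k) (c z).
    by rewrite rV_ballE// => i; rewrite !mxE; exact: (svalP (q i)).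
  exists (z, k) => /=; last exact: ball_sym.
  move=> y zy; apply: eU; apply: le_ball (ball_triangle xz zy).
  by rewrite [e]splitr ltW// ltrD.
rewrite bigcup_mkcond.
apply: countable_bigcupT_measurable => // -[z k] /=; case: ifPn => // _.
by apply: measurable_rV_ball; rewrite invr_gt0.
Qed.

End rV_topology.

Section lebesgue_integral_rV.
Context {R : realType}.

Lemma integral_lebesgue_rVS n (F : 'rV[R]_n.+1 -> \bar R) :
  measurable_fun setT F -> (forall v, 0 <= F v)%E ->
  (\int[lebesgue_rV n.+1]_v F v =
   \int[lebesgue_measure]_x \int[lebesgue_rV n]_v F (rV_cons (x, v)))%E.
Proof.
move=> mF F0; rewrite [LHS](ge0_integral_pushforward (@measurable_rV_cons R n))//.
rewrite preimage_setT (fubini_tonelli1 (F \o @rV_cons R n)) => [//||z]; last exact: F0.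
by apply: measurableT_comp => //; exact: measurable_rV_cons.
Qed.

(** The image of Lebesgue measure under [x |-> a - h * x], scaled by [h], gives each interval its
    length, so by uniqueness it is Lebesgue measure. *)
Lemma ge0_integral_affine (a h : R) (F : R -> \bar R) : 0 < h ->
  measurable_fun setT F -> (forall x, 0 <= F x)%E ->
  (h%:E * \int[lebesgue_measure]_x F (a - h * x)%R =
   \int[lebesgue_measure]_x F x)%E.
Proof.
move=> h0 mF F0.
pose phi (x : measurableTypeR R) : measurableTypeR R := a - h * x.
have mphi : measurable_fun setT phi.
  by apply: measurable_funB => //; exact: measurable_funM.
pose nu :=
  measure_function_pushforward__canonical__measure_function_Measure
    lebesgue_measure mphi.
pose m := mscale (NngNum (ltW h0)) nu.
have mE A : measurable A -> lebesgue_measure A = m A.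
  apply: lebesgue_measure_unique => // _ [[b c]] _ <-.
  rewrite -[RHS]/(h%:E * lebesgue_measure (phi @^-1` `]b, c]))%E.
  (* The map reverses orientation, so the closed end changes sides. *)
  rewrite (_ : phi @^-1` _ = `[(a - c) / h, (a - b) / h[%classic); last first.
    apply/seteqP; rewrite /phi; split => x /=; rewrite !in_itv/= => /andP[bx xc].
      by rewrite ler_pdivrMr// ltr_pdivlMr//; lra.
    by move: bx xc; rewrite ler_pdivrMr// ltr_pdivlMr//; lra.
  rewrite !lebesgue_measure_itv/= !lte_fin ltr_pM2r ?invr_gt0// ltrD2l ltrN2.
  case: ifPn => // _; last by rewrite mule0.
  by rewrite -!EFinB -EFinM; congr EFin; field; rewrite gt_eqF.
transitivity (h%:E * \int[nu]_x F x)%E.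
  by congr *%E; rewrite [RHS](ge0_integral_pushforward mphi)// preimage_setT.
rewrite -(@ge0_integral_mscale _ _ _ nu _ measurableT (NngNum (ltW h0)) F)//.
by apply: eq_measure_integral => A mA _; exact/esym/mE.
Qed.

Lemma measurable_rV_affine n (a : 'rV[R]_n) (h : R) :
  measurable_fun setT (fun v : 'rV[R]_n => a - h *: v).
Proof.
apply: measurable_fun_rV => i; under eq_fun do rewrite !mxE.
apply: measurable_funB => //; apply: measurable_funM => //.
exact: measurable_rV_coord.
Qed.

(** Induction on the dimension: the first coordinate is substituted by the one-dimensional rule, the
    others by the induction hypothesis, and each coordinate contributes a factor [h]. *)
Lemma ge0_integral_rV_affine n (a : 'rV[R]_n) (h : R) (F : 'rV[R]_n -> \bar R) :
  0 < h -> measurable_fun setT F -> (forall v, 0 <= F v)%E ->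
  ((h ^+ n)%:E * \int[lebesgue_rV n]_v F (a - h *: v)%R =
   \int[lebesgue_rV n]_v F v)%E.
Proof.
move=> h0; elim: n a F => [|n IHn] a F mF F0.
  by rewrite mul1e; apply: eq_integral => v _; congr F; apply/rowP => -[].
rewrite !integral_lebesgue_rVS//; last first.
  by apply: measurableT_comp => //; exact: measurable_rV_affine.
pose a' : 'rV[R]_n := \row_i a ord0 (lift ord0 i).
pose G x := (\int[lebesgue_rV n]_v F (rV_cons (x, v)))%E.
have mFc : measurable_fun setT (F \o @rV_cons R n).
  by apply: measurableT_comp => //; exact: measurable_rV_cons.
have mG : measurable_fun setT G.
  apply: (measurable_fun_fubini_tonelli_F (F \o @rV_cons R n)) => // z.
  exact: F0.
have G0 x : (0 <= G x)%E by exact: integral_ge0.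
have mFx x : measurable_fun setT (fun v : 'rV[R]_n => F (rV_cons (x, v))).
  exact: (measurableT_comp mFc (pair1_measurable x)).
rewrite exprS EFinM -muleA -ge0_integralZl//; last 3 first.
- apply: (measurable_fun_fubini_tonelli_F
    (F \o (fun v => a - h *: v) \o @rV_cons R n)) => [|z]; last exact: F0.
  apply: measurableT_comp; last exact: measurable_rV_cons.
  by apply: measurableT_comp => //; exact: measurable_rV_affine.
- by move=> x _; exact: integral_ge0.
- by rewrite lee_fin exprn_ge0// ltW.
rewrite -[RHS](ge0_integral_affine (a ord0 ord0) h0 mG G0).
congr (_ * _)%E; apply: eq_integral => x _; rewrite /G.
rewrite -[RHS](IHn a')//; congr (_ * _)%E; apply: eq_integral => v _; congr F.
apply/rowP => i; rewrite !mxE.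
by case: unliftP => [j ->|->] //=; rewrite !mxE.
Qed.

End lebesgue_integral_rV.

(** * The exponential kernel *)

Section exponential_integrals.
Context {R : realType}.

(** The integrand is dominated by [1 / a] times the sum of the exponential density and its
    reflection at 0, each of total mass 1. *)
Lemma integral_expR_abs_lty (a : R) : 0 < a ->
  (\int[lebesgue_measure]_x (expR (- (a * `|x|)))%:E < +oo)%E.
Proof.
move=> a0.
have m1 : measurable_fun setT (fun x : R => (exponential_pdf a x)%:E).
  by apply/measurable_EFinP; exact: measurable_exponential_pdf.
have m2 : measurable_fun setT (fun x : R => (exponential_pdf a (0 - 1 * x))%:E).
  by apply: (measurableT_comp m1); exact: measurable_funB.
have p0 x : (0 <= (exponential_pdf a x)%:E)%E.
  by rewrite lee_fin exponential_pdf_ge0// ltW.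
have := ge0_integral_affine 0 (@ltr01 R) m1 p0.
rewrite mul1e integral_exponential_pdf// => refl1.
apply: (@le_lt_trans _ _ (\int[lebesgue_measure]_x ((a^-1)%:E *
    ((exponential_pdf a x)%:E + (exponential_pdf a (0 - 1 * x))%:E)))%E).
  apply: ge0_le_integral => //.
  - apply/measurable_EFinP; apply: measurableT_comp => //.
    by apply: measurableT_comp => //; exact: measurable_funM.
  - by apply: measurable_funeM; exact: emeasurable_funD.
  - move=> x _; rewrite -EFinD -EFinM lee_fin ler_pdivlMl//.
    have [x0|x0] := leP 0 x.
      rewrite [exponential_pdf a x]exponential_pdfE// ger0_norm// mulNr.
      by rewrite lerDl exponential_pdf_ge0// ltW.
    rewrite [exponential_pdf a (_ - _)]exponential_pdfE; last by lra.
    rewrite ltr0_norm// (_ : - a * _ = - (a * - x)); last by ring.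
    by rewrite lerDr exponential_pdf_ge0// ltW.
rewrite ge0_integralZl//; last 3 first.
- exact: emeasurable_funD.
- by move=> x _; exact: adde_ge0.
- by rewrite lee_fin invr_ge0 ltW.
by rewrite ge0_integralD// integral_exponential_pdf// refl1 -EFinD -EFinM ltry.
Qed.

(** Unlike the Euclidean norm, the l1 norm makes the exponential factor over the coordinates, so the
    integral is a product of one-dimensional ones. *)
Lemma integral_expR_norm1_lty n (a : R) : 0 < a ->
  (\int[lebesgue_rV n]_v (expR (- (a * \sum_i `|v ord0 i|)))%:E < +oo)%E.
Proof.
move=> a0; elim: n => [|n IHn].
  rewrite /= integral_dirac//; last first.
    apply/measurable_EFinP; rewrite [X in measurable_fun _ X](_ : _ = cst 1)//.
    by apply/funext => v; rewrite big_ord0 mulr0 oppr0 expR0.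
  by rewrite diracE mem_set// mul1e ltry.
have mF m : measurable_fun setT (fun v : 'rV[R]_m =>
    (expR (- (a * \sum_i `|v ord0 i|)))%:E).
  apply/measurable_EFinP; apply: measurableT_comp => //.
  apply: measurableT_comp => //; apply: measurable_funM => //.
  apply: measurable_sum => i; apply: measurableT_comp => //.
  exact: measurable_rV_coord.
rewrite integral_lebesgue_rVS//.
have [r r0 rE] : exists2 r, 0 <= r &
    (\int[lebesgue_rV n]_v (expR (- (a * \sum_i `|v ord0 i|)))%:E = r%:E)%E.
  exists (fine (\int[lebesgue_rV n]_v (expR (- (a * \sum_i `|v ord0 i|)))%:E)).
    by apply: fine_ge0; exact: integral_ge0.
  by rewrite fineK// ge0_fin_numE//; exact: integral_ge0.
under eq_integral => x _.
  under eq_integral => v _.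
    rewrite big_ord_recl mxE unlift_none/=.
    under eq_bigr do rewrite mxE liftK/=.
    rewrite mulrDr opprD expRD EFinM.
    over.
  rewrite ge0_integralZl//; last exact: mF.
  rewrite rE.
  over.
rewrite ge0_integralZr//; last first.
  apply/measurable_EFinP; apply: measurableT_comp => //.
  by apply: measurableT_comp => //; exact: measurable_funM.
have I0 : (0 <= \int[@lebesgue_measure R]_x (expR (- (a * `|x|)))%:E)%E.
  exact: integral_ge0.
by rewrite lte_mul_pinfty ?ltry// ge0_fin_numE// integral_expR_abs_lty.
Qed.

End exponential_integrals.

Section kernel.
Context {R : realType} {p : nat}.
Implicit Types v : 'rV[R]_p.

Lemma measurable_enorm : measurable_fun setT (@enorm R p).
Proof.
apply: (measurableT_comp (f := @Num.sqrt R)).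
  by apply: continuous_measurable_fun; exact: sqrt_continuous.
apply: measurable_sum => i; apply: measurable_funX; exact: measurable_rV_coord.
Qed.

Lemma enorm_ge0 v : 0 <= enorm v. Proof. exact: sqrtr_ge0. Qed.

(** Each coordinate is bounded by the Euclidean norm. The constant [p.+1] instead of [p] can be
    divided by in dimension 0 too. *)
Lemma norm1_le_enorm v : \sum_i `|v ord0 i| <= p.+1%:R * enorm v.
Proof.
apply: (@le_trans _ _ (\sum_(i < p) enorm v)).
  apply: ler_sum => i _; rewrite -sqrtr_sqr ler_wsqrtr// (bigD1 i)//=.
  by rewrite lerDl; apply: sumr_ge0 => j _; exact: sqr_ge0.
rewrite sumr_const card_ord -[leLHS]mulr_natl ler_wpM2r ?enorm_ge0//.
by rewrite ler_nat.
Qed.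

Lemma integral_expR_enorm_lty (b : R) : 0 < b ->
  (\int[lebesgue_rV p]_v (expR (- (b * enorm v)))%:E < +oo)%E.
Proof.
move=> b0; have b1 : 0 < b / p.+1%:R by rewrite divr_gt0.
apply: le_lt_trans (integral_expR_norm1_lty p b1).
apply: ge0_le_integral => //.
- apply/measurable_EFinP; apply: measurableT_comp => //.
  apply: measurable_funN; apply: measurable_funM => //.
  exact: measurable_enorm.
- apply/measurable_EFinP; apply: measurableT_comp => //.
  apply: measurable_funN; apply: measurable_funM => //.
  apply: measurable_sum => i; apply: measurableT_comp => //.
  exact: measurable_rV_coord.
move=> v _; rewrite lee_fin ler_expR lerN2 -mulrA ler_pM2l//.
by rewrite ler_pdivrMl// norm1_le_enorm.
Qed.

Lemma kernel_cstE :
  (\int[lebesgue_rV p]_v (expR (- enorm v))%:E = (@kernel_cst R p)%:E)%E.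
Proof.
rewrite /kernel_cst /Rintegral fineK// ge0_fin_numE ?integral_ge0//.
rewrite (eq_integral (fun v : 'rV[R]_p => (expR (- (1 * enorm v)))%:E)).
  exact: integral_expR_enorm_lty.
by move=> v _; rewrite mul1r.
Qed.

Lemma measurable_expR_enorm :
  measurable_fun setT (fun v : 'rV[R]_p => expR (- enorm v)).
Proof.
apply: measurableT_comp => //; apply: measurable_funN; exact: measurable_enorm.
Qed.

(** On the sup-norm unit ball the Euclidean norm is at most [Num.sqrt p], so the integrand is
    bounded below there, and this ball has positive volume. *)
Lemma kernel_cst_gt0 : 0 < @kernel_cst R p.
Proof.
rewrite -lte_fin -kernel_cstE.
pose B : set 'rV[R]_p := ball 0 1.
have mB : measurable B by exact: measurable_rV_ball.
pose c : R := expR (- Num.sqrt p%:R).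
have c0 : (0 < \int[lebesgue_rV p]_(v in B) c%:E)%E.
  rewrite integral_cst// [X in (_ * X)%E]lebesgue_rV_ball// -EFinM lte_fin.
  by apply: mulr_gt0; [exact: expR_gt0|rewrite exprn_gt0].
have cle : (\int[lebesgue_rV p]_(v in B) c%:E <=
    \int[lebesgue_rV p]_(v in B) (expR (- enorm v))%:E)%E.
  apply: ge0_le_integral => //.
  - by move=> v _; rewrite lee_fin expR_ge0.
  - by apply/measurable_EFinP/measurable_funTS; exact: measurable_expR_enorm.
  move=> v; rewrite /B rV_ballE// => Bv; rewrite lee_fin ler_expR lerN2.
  rewrite ler_wsqrtr// -[p in leRHS]card_ord -sumr_const ler_sum// => i _.
  have := Bv i; rewrite mxE /ball/= sub0r normrN => vi.
  by rewrite -real_normK ?num_real// expr_le1// ltW.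
apply: (lt_le_trans c0); apply: (le_trans cle).
apply: ge0_subset_integral => //.
by apply/measurable_EFinP; exact: measurable_expR_enorm.
Qed.

Lemma NW_kernel_gt0 v : 0 < NW_kernel v.
Proof. by rewrite mulr_gt0 ?expR_gt0// invr_gt0 kernel_cst_gt0. Qed.

Lemma NW_kernel_le v : NW_kernel v <= (@kernel_cst R p)^-1.
Proof.
rewrite /NW_kernel ler_piMr ?invr_ge0 ?(ltW kernel_cst_gt0)//.
by rewrite -[leRHS]expR0 ler_expR oppr_le0 enorm_ge0.
Qed.

Lemma measurable_NW_kernel : measurable_fun setT (@NW_kernel R p).
Proof. by apply: measurable_funM => //; exact: measurable_expR_enorm. Qed.

Lemma integral_NW_kernel :
  (\int[lebesgue_rV p]_v (@NW_kernel R p v)%:E = 1)%E.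
Proof.
under eq_integral do rewrite EFinM.
rewrite ge0_integralZl//; last 2 first.
- by apply/measurable_EFinP; exact: measurable_expR_enorm.
- by rewrite lee_fin invr_ge0 ltW// kernel_cst_gt0.
by rewrite kernel_cstE -EFinM mulVf// gt_eqF// kernel_cst_gt0.
Qed.

(** This first moment enters the bias constant of the kernel estimator. Half of the exponential
    decay absorbs the linear factor, by [t / 2 <= expR (t / 2)]; the other half is integrable. *)
Lemma integral_NW_kernel_norm1_lty :
  (\int[lebesgue_rV p]_v (@NW_kernel R p v * \sum_i `|v ord0 i|)%:E < +oo)%E.
Proof.
pose k : R := (@kernel_cst R p)^-1 * (p.+1%:R * 2).
have k0 : 0 <= k by rewrite mulr_ge0// invr_ge0 ltW// kernel_cst_gt0.
have mE : measurable_fun setT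
    (fun v : 'rV[R]_p => (expR (- (2^-1 * enorm v)))%:E).
  apply/measurable_EFinP; apply: measurableT_comp => //.
  apply: measurable_funN; apply: measurable_funM => //.
  exact: measurable_enorm.
apply: (@le_lt_trans _ _
    (\int[lebesgue_rV p]_v (k%:E * (expR (- (2^-1 * enorm v)))%:E))%E).
  apply: ge0_le_integral => //.
  - by move=> v _; rewrite lee_fin mulr_ge0 ?sumr_ge0// ltW// NW_kernel_gt0.
  - apply/measurable_EFinP; apply: measurable_funM.
      exact: measurable_NW_kernel.
    apply: measurable_sum => i; apply: measurableT_comp => //.
    exact: measurable_rV_coord.
  - exact: measurable_funeM.
  move=> v _; rewrite -EFinM lee_fin /NW_kernel /k -!mulrA ler_wpM2l//.
    by rewrite invr_ge0 ltW// kernel_cst_gt0.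
  rewrite (_ : - enorm v = - (2^-1 * enorm v) + - (2^-1 * enorm v)); last by lra.
  rewrite expRD -mulrA [leRHS]mulrA [leRHS]mulrC ler_pM2l ?expR_gt0//.
  rewrite expRN ler_pdivrMl ?expR_gt0// (le_trans (norm1_le_enorm v))//.
  have := expR_ge1Dx (2^-1 * enorm v) => e1.
  rewrite [leRHS]mulrC -mulrA ler_wpM2l//; lra.
by rewrite ge0_integralZl// lte_mul_pinfty ?lee_fin// integral_expR_enorm_lty.
Qed.

End kernel.

(** * Smooth densities and their support *)

Section joint_density_lemmas.
Context {R : realType} {p q : nat}.
Implicit Types (f : 'rV[R]_p * 'rV[R]_q -> R).

Lemma is_derive_line (W : normedModType R) (f : W -> R) (z v : W) (t : R) :
  differentiable f (t *: v + z) ->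
  is_derive t 1 (fun s : R => f (s *: v + z)) ('D_v f (t *: v + z)).
Proof.
move=> df; have dv : derivable f (t *: v + z) v by exact: diff_derivable.
have E : (fun h : R => h^-1 *:
      (((fun s : R => f (s *: v + z)) \o shift t) (h *: 1) - f (t *: v + z))) =
    (fun h : R => h^-1 *:
      ((f \o shift (t *: v + z)) (h *: v) - f (t *: v + z))).
  by apply/funext => h /=; rewrite [h *: 1]mulr1 scalerDl addrA.
by split; rewrite /derivable/derive E.
Qed.

(** Mean value theorem on the segment from [(u', xi)] to [(u, xi)]: its direction has components
    only in the first block, and the derivative is linear in the direction, so bounds on the
    first-block partial derivatives suffice, uniformly in [xi]. *)
Lemma density_lipschitz f : twice_differentiable_bounded f ->
  exists2 L : R, 0 <= L & forall u u' xi,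
    `|f (u, xi) - f (u', xi)| <= L * \sum_i `|u ord0 i - u' ord0 i|.
Proof.
move=> [df _ bf _].
have /choice[B HB] (i : 'I_p) : exists B : R, forall z, `|partial (inl i) f z| <= B.
  by have [_ [B ?]] := bf (inl i); exists B.
have B0 i : 0 <= B i by exact: le_trans (HB i 0).
exists (\sum_i B i) => [|u u' xi]; first exact: sumr_ge0.
pose w : 'rV[R]_p * 'rV[R]_q := (u - u', 0).
pose z : 'rV[R]_p * 'rV[R]_q := (u', xi).
have wE : w = \sum_i (u - u') ord0 i *: std_basis (inl i).
  apply: injective_projections => /=.
    rewrite (big_morph fst (id1 := 0) (op1 := +%R))//= [LHS]row_sum_delta.
    by apply: eq_bigr.
  rewrite (big_morph snd (id1 := 0) (op1 := +%R))//= big1// => i _.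
  by rewrite scaler0.
have dphi (t : R) : is_derive t (1 : R)
    (fun s : R => f (s *: w + z)) ('D_w f (t *: w + z)).
  exact: is_derive_line.
have [|c _] := @MVT_segment R (fun s => f (s *: w + z)) _ 0 1 ler01
    (fun t _ => dphi t).
  apply: continuous_subspaceT => t.
  by apply/differentiable_continuous/derivable1_diffP; case: (dphi t).
rewrite scale1r scale0r add0r subr0 mulr1 (_ : w + z = (u, xi)); last first.
  by rewrite /w /z; congr pair; rewrite ?subrK ?add0r.
move=> ->; rewrite deriveE// wE linear_sum.
apply: (le_trans (ler_norm_sum _ _ _)); rewrite mulr_sumr; apply: ler_sum => i _.
rewrite linearZ/= normrM mulrC !mxE ler_wpM2r// -deriveE//.
apply: le_trans (HB i _) _; rewrite (bigD1 i)//= lerDl.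
by apply: sumr_ge0.
Qed.

Lemma density_continuous f : twice_differentiable_bounded f -> continuous f.
Proof. by move=> [df _ _ _] z; exact: differentiable_continuous. Qed.

(** Off the support, [xi] has an open neighbourhood [U] of probability 0. Were the density positive
    at [(u, xi)], it would by continuity exceed half that value on a box whose second side lies in
    [U], and the box would have positive probability. *)
Lemma density_eq0_off_support f d (Omega : measurableType d) (P : probability Omega R)
    (V : {RV P >-> ('rV[R]_p * 'rV[R]_q)%type}) u xi :
  has_density (distribution P V) f -> continuous f ->
  ~ topological_support (pushforward P (fun o => (V o).2)) xi -> f (u, xi) = 0.
Proof.
move=> [f0 mf fE] cf /existsNP[U /not_implyP[oU /not_implyP[Uxi /negP]]].
rewrite -leNgt => PU0; apply/eqP/negPn/negP => fn0.
have fp : 0 < f (u, xi) by rewrite lt_def fn0 f0.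
have mU := measurable_rV_open oU.
have [e e0 fe] : exists2 e, 0 < e & forall u' xi', ball u e u' ->
    ball xi e xi' -> f (u, xi) / 2 <= f (u', xi') /\ U xi'.
  have /nbhs_ballP[e1 /= e10 e1U] : nbhs xi U by exact: open_nbhs_nbhs.
  have /cvgrPdist_lt/(_ (f (u, xi) / 2)) := cf (u, xi).
  move=> /(_ (divr_gt0 fp (ltr0Sn _ _)))/nbhs_ballP[e2 /= e20 e2f].
  exists (Num.min e1 e2); first by rewrite lt_min e10.
  move=> u' xi' uu' xx'; split.
    have : `|f (u, xi) - f (u', xi')| < f (u, xi) / 2.
      by apply: e2f; split => /=; [move: uu'|move: xx']; apply: le_ball;
        rewrite ge_min lexx orbT.
    by rewrite ltr_distlC => /andP[+ _]; lra.
  by apply: e1U; move: xx'; apply: le_ball; rewrite ge_min lexx.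
pose A : set ('rV[R]_p * 'rV[R]_q) := ball u e `*` ball xi e.
have mB1 := measurable_rV_ball u e0; have mB2 := measurable_rV_ball xi e0.
have mA : measurable A by exact: measurableX.
have : (distribution P V A <= 0)%E.
  rewrite /pushforward in PU0; rewrite /distribution /pushforward.
  apply: le_trans PU0; apply: le_measure; rewrite ?inE.
  - by rewrite -[X in measurable X]setTI; exact: (measurable_funP V).
  - rewrite -[X in measurable X]setTI.
    exact: (measurableT_comp measurable_snd (measurable_funP V)).
  - by move=> o [/= Bu Bxi]; exact: (fe _ _ Bu Bxi).2.
rewrite fE//; apply/negP; rewrite -ltNge.
have : (0 < \int[lebesgue_rV p \x lebesgue_rV q]_(z in A) (f (u, xi) / 2)%:E)%E.
  have AE : (lebesgue_rV p \x lebesgue_rV q)%E A =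
      ((e *+ 2) ^+ p * (e *+ 2) ^+ q)%:E.
    by rewrite product_measure1E// EFinM; congr (_ * _)%E;
      exact: lebesgue_rV_ball.
  rewrite integral_cst// [X in (_ * X)%E]AE -EFinM lte_fin !mulr_gt0// exprn_gt0//.
    by rewrite pmulrn_lgt0.
  by rewrite pmulrn_lgt0.
move/lt_le_trans; apply; apply: ge0_le_integral => //.
- by move=> z _; rewrite lee_fin divr_ge0// ltW.
- by apply/measurable_EFinP/measurable_funTS.
by move=> [u' xi'] [/= Bu Bxi]; rewrite lee_fin; exact: (fe _ _ Bu Bxi).1.
Qed.

End joint_density_lemmas.

(** * Mean of a kernel-weighted observation *)

Section integral_against_density.
Local Open Scope ereal_scope.
Context d (T : measurableType d) (R : realType).
Variables (nu : {finite_measure set T -> \bar R})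
          (mu : {sigma_finite_measure set T -> \bar R}) (f : T -> R).
Hypotheses (f0 : forall x, (0 <= f x)%R) (mf : measurable_fun setT f).
Hypothesis nuE : forall A, measurable A -> nu A = \int[mu]_(x in A) (f x)%:E.

Lemma integral_density (g : T -> \bar R) : measurable_fun setT g ->
  (forall x, 0 <= g x) -> \int[nu]_x g x = \int[mu]_x (g x * (f x)%:E).
Proof.
move=> mg g0.
have mEf : measurable_fun setT (EFin \o f) by exact/measurable_EFinP.
have numu : nu `<< mu.
  apply/null_content_dominatesP => A mA muA0; rewrite nuE//.
  by apply: null_set_integral => //; exact: measurable_funTS.
pose r := Radon_Nikodym_SigmaFinite.f nu mu.
have r0 := Radon_Nikodym_SigmaFinite.f_ge0 numu.
have ir := Radon_Nikodym_SigmaFinite.f_integrable numu.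
(* The Radon-Nikodym derivative and [f] have the same integral over every measurable set, hence
   agree almost everywhere. *)
have rf : ae_eq mu setT r (EFin \o f).
  apply: integral_ae_eq => // E _ mE.
  by rewrite -Radon_Nikodym_SigmaFinite.f_integral// nuE.
rewrite -(Radon_Nikodym_SigmaFinite.change_of_variables numu)//.
apply: ge0_ae_eq_integral => //.
- by apply: emeasurable_funM => //; exact: measurable_int ir.
- exact: emeasurable_funM.
- by move=> x _; rewrite mule_ge0.
- by move=> x _; rewrite mule_ge0// lee_fin.
- exact: ae_eqe_mul2l.
Qed.

End integral_against_density.

Lemma integral_density_prod d1 d2 (T1 : measurableType d1)
    (T2 : measurableType d2) (R : realType)
    (m1 : {sigma_finite_measure set T1 -> \bar R})
    (m2 : {sigma_finite_measure set T2 -> \bar R})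
    (nu : {finite_measure set (T1 * T2)%type -> \bar R})
    (f : T1 * T2 -> R) (g : T1 * T2 -> \bar R) :
  (forall z, 0 <= f z) -> measurable_fun setT f ->
  (forall A, measurable A -> nu A = (\int[m1 \x m2]_(z in A) (f z)%:E)%E) ->
  measurable_fun setT g -> (forall z, 0 <= g z)%E ->
  (\int[nu]_z g z = \int[m1 \x m2]_z (g z * (f z)%:E))%E.
Proof.
(* The library's instance for products of probabilities hides the one for
   products of sigma-finite measures, which is therefore rebuilt here. *)
have [sf] :=
  lebesgue_integral_fubini.measure_function_Measure_isSigmaFinite__to__measure_function_isSigmaFinite
    m1 m2.
pose mu : {sigma_finite_measure set (T1 * T2)%type -> \bar R} :=
  HB.pack (m1 \x m2)%E (Measure_isSigmaFinite.Build _ _ _ (m1 \x m2)%E sf).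
move=> f0 mf fE mg g0.
exact: (@integral_density _ _ R nu mu f f0 mf fE g mg g0).
Qed.

Section kernel_mean.
Context {R : realType} {p q : nat}.
Variables (f : 'rV[R]_p * 'rV[R]_q -> R) (gamma : 'rV[R]_p).
Variables (L : R) (Xi : set 'rV[R]_q).
Hypotheses (f0 : forall z, 0 <= f z) (mf : measurable_fun setT f).
Hypothesis L0 : 0 <= L.
Hypothesis fL : forall u u' xi,
  `|f (u, xi) - f (u', xi)| <= L * \sum_i `|u ord0 i - u' ord0 i|.
Hypotheses (mXi : measurable Xi) (Xioo : (lebesgue_rV q Xi < +oo)%E).
Hypothesis fXi : forall u xi, ~ Xi xi -> f (u, xi) = 0.
Hypothesis foo : (\int[lebesgue_rV q]_xi (f (gamma, xi))%:E < +oo)%E.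

(** The unnormalised conditional mean of [phi] at [u], possibly infinite away from [gamma]. *)
Let G (phi : 'rV[R]_q -> R) u :=
  (\int[lebesgue_rV q]_xi (phi xi * f (u, xi))%:E)%E.

Let l : R := fine (lebesgue_rV q Xi).

Let lE : lebesgue_rV q Xi = l%:E.
Proof. by rewrite fineK// ge0_fin_numE. Qed.

Let m1 : R :=
  fine (\int[lebesgue_rV p]_v (@NW_kernel R p v * \sum_i `|v ord0 i|)%:E).

Let kernel_norm1_ge0 (v : 'rV[R]_p) : 0 <= NW_kernel v * \sum_i `|v ord0 i|.
Proof. by rewrite mulr_ge0 ?sumr_ge0// ltW// NW_kernel_gt0. Qed.

Let m1E : (\int[lebesgue_rV p]_v (@NW_kernel R p v * \sum_i `|v ord0 i|)%:E =
  m1%:E)%E.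
Proof.
rewrite fineK// ge0_fin_numE ?integral_NW_kernel_norm1_lty//.
by apply: integral_ge0 => v _; rewrite lee_fin.
Qed.

Let m1_ge0 : 0 <= m1.
Proof.
by rewrite -lee_fin -m1E; apply: integral_ge0 => v _; rewrite lee_fin.
Qed.

Let l_ge0 : 0 <= l. Proof. by rewrite -lee_fin -lE. Qed.

Let measurable_section u : measurable_fun setT (fun xi => f (u, xi)).
Proof. exact: (measurableT_comp mf (pair1_measurable u)). Qed.

(** The integrands differ by at most [L] times the l1 distance on [Xi] and vanish off it, hence the
    factor [l], the volume of [Xi]. The additive form avoids subtracting infinite values. *)
Let G_lipschitz (phi : 'rV[R]_q -> R) u u' : measurable_fun setT phi ->
  (forall xi, 0 <= phi xi <= 1) ->
  (G phi u <= G phi u' + (L * l * \sum_i `|u ord0 i - u' ord0 i|)%:E)%E.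
Proof.
move=> mphi phi01.
have p0 xi : 0 <= phi xi by case/andP: (phi01 xi).
pose s := \sum_i `|u ord0 i - u' ord0 i|.
have s0 : 0 <= s by exact: sumr_ge0.
have mpf v : measurable_fun setT (fun xi => (phi xi * f (v, xi))%:E).
  by apply/measurable_EFinP; apply: measurable_funM.
have m1Xi : measurable_fun setT (fun xi => ((L * s)%:E * (\1_Xi xi)%:E)%E).
  by apply: measurable_funeM; exact/measurable_EFinP.
have -> : (L * l * s)%:E =
    (\int[lebesgue_rV q]_xi ((L * s)%:E * (\1_Xi xi)%:E))%E.
  rewrite ge0_integralZl//; last 2 first.
  - exact/measurable_EFinP.
  - by rewrite lee_fin mulr_ge0.
  by rewrite integral_indic// setIT [X in (_ * X)%E]lE -EFinM mulrAC.
rewrite -ge0_integralD//; last 2 first.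
- by move=> xi _; rewrite lee_fin mulr_ge0.
- by move=> xi _; rewrite mule_ge0// lee_fin// mulr_ge0.
apply: ge0_le_integral => //.
- by move=> xi _; rewrite lee_fin mulr_ge0.
- exact: emeasurable_funD.
move=> xi _; rewrite -EFinM -EFinD lee_fin indicE.
have [Xixi|/fXi nXi] := pselect (Xi xi); last first.
  by rewrite !nXi !mulr0 add0r mulr_ge0// mulr_ge0.
rewrite mem_set// mulr1 -lerBlDl -mulrBr.
apply: le_trans (fL u u' xi).
apply: (@le_trans _ _ (phi xi * `|f (u, xi) - f (u', xi)|)).
  by rewrite ler_wpM2l// ler_norm.
by rewrite ler_piMl//; case/andP: (phi01 xi).
Qed.

(** Lipschitz constant of [G phi] times the first absolute moment of the kernel. *)
Let C : R := L * l * m1.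

Let measurable_G (phi : 'rV[R]_q -> R) : measurable_fun setT phi ->
  (forall xi, 0 <= phi xi) -> measurable_fun setT (G phi).
Proof.
move=> mphi phi0; apply: (measurable_fun_fubini_tonelli_F
  (fun z : 'rV[R]_p * 'rV[R]_q => (phi z.2 * f (z.1, z.2))%:E)) => [|z].
  apply/measurable_EFinP; apply: measurable_funM.
    by apply: measurableT_comp.
  rewrite (_ : (fun _ => _) = f)//.
  by apply/funext => -[].
by rewrite lee_fin mulr_ge0.
Qed.

(** The substitution leaves [h ^+ p] times a kernel average of [G phi] near [gamma], and the
    Lipschitz bound controls its bias. The constant is chosen before [h] and [phi], as the limit in
    the bandwidth requires. *)
Lemma kernel_mean : exists2 C : R, 0 <= C &
  forall (h : R) (phi : 'rV[R]_q -> R), 0 < h ->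
  measurable_fun setT phi -> (forall xi, 0 <= phi xi <= 1) ->
  exists2 r : R,
   (\int[lebesgue_rV p \x lebesgue_rV q]_z
     ((NW_kernel (h^-1 *: (gamma - z.1)) * phi z.2)%:E * (f z)%:E) =
    (h ^+ p * r)%:E)%E &
   `|r - \int[lebesgue_rV q]_xi (phi xi * f (gamma, xi))| <= C * h.
Proof.
exists C => [|h phi h0 mphi phi01]; first by rewrite !mulr_ge0.
have p0 xi : 0 <= phi xi by case/andP: (phi01 xi).
have G0 u : (0 <= G phi u)%E.
  by apply: integral_ge0 => xi _; rewrite lee_fin mulr_ge0.
pose a := \int[lebesgue_rV q]_xi (phi xi * f (gamma, xi)).
have aE : G phi gamma = a%:E.
  rewrite -[RHS]/((fine (G phi gamma))%:E) fineK// ge0_fin_numE//.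
  apply: le_lt_trans foo; apply: ge0_le_integral => //.
  - by move=> xi _; rewrite lee_fin mulr_ge0.
  - by apply/measurable_EFinP; exact: measurable_funM.
  - exact/measurable_EFinP.
  by move=> xi _; rewrite lee_fin ler_piMl//; case/andP: (phi01 xi).
have a0 : 0 <= a by rewrite -lee_fin -aE.
pose k (v : 'rV[R]_p) := @NW_kernel R p v.
have k0 v : 0 <= k v by rewrite ltW// NW_kernel_gt0.
have kE0 v : (0 <= (k v)%:E)%E by rewrite lee_fin.
have aE0 : (0 <= a%:E)%E by rewrite lee_fin.
have mk := @measurable_NW_kernel R p.
pose K u := k (h^-1 *: (gamma - u)).
have mK : measurable_fun setT K.
  rewrite /K (_ : (fun _ => _) =
      k \o (fun v : 'rV[R]_p => h^-1 *: gamma - h^-1 *: v)).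
    by apply: measurableT_comp => //; exact: measurable_rV_affine.
  by apply/funext => u /=; rewrite scalerBr.
have KE v : K (gamma - h *: v) = k v.
  by rewrite /K opprB addrC subrK scalerA mulVf ?gt_eqF// scale1r.
have mG := measurable_G mphi p0.
pose J := (\int[lebesgue_rV p]_v ((k v)%:E * G phi (gamma - h *: v)%R))%E.
have mGa : measurable_fun setT (fun v : 'rV[R]_p => G phi (gamma - h *: v)).
  by apply: measurableT_comp => //; exact: measurable_rV_affine.
have -> : (\int[lebesgue_rV p \x lebesgue_rV q]_z
    ((NW_kernel (h^-1 *: (gamma - z.1)) * phi z.2)%:E * (f z)%:E) =
    (h ^+ p)%:E * J)%E.
  rewrite fubini_tonelli1; last 2 first.
  - apply: emeasurable_funM; last exact/measurable_EFinP.
    apply/measurable_EFinP; apply: measurable_funM.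
      exact: (measurableT_comp mK measurable_fst).
    exact: (measurableT_comp mphi measurable_snd).
  - by move=> z; rewrite mule_ge0 ?lee_fin// mulr_ge0// ltW// NW_kernel_gt0.
  transitivity (\int[lebesgue_rV p]_u ((K u)%:E * G phi u))%E.
    apply: eq_integral => u _; rewrite /fubini_F -ge0_integralZl//.
    - by apply: eq_integral => xi _; rewrite -!EFinM mulrA.
    - by apply/measurable_EFinP; exact: measurable_funM.
    - by move=> xi _; rewrite lee_fin mulr_ge0.
    - by rewrite lee_fin; exact: k0.
  pose F u := ((K u)%:E * G phi u)%E.
  have mF : measurable_fun setT F.
    by apply: emeasurable_funM => //; exact/measurable_EFinP.
  have F0 u : (0 <= F u)%E by rewrite mule_ge0// lee_fin; exact: k0.
  rewrite -[LHS](ge0_integral_rV_affine gamma h0 mF F0).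
  rewrite (eq_integral (fun v => (k v)%:E * G phi (gamma - h *: v)%R)%E)//.
  by move=> v _; rewrite /F KE.
have n1E v : \sum_i `|(gamma - h *: v) ord0 i - gamma ord0 i| =
    h * \sum_i `|v ord0 i|.
  rewrite mulr_sumr; apply: eq_bigr => i _; rewrite !mxE addrAC subrr add0r.
  by rewrite normrN normrM gtr0_norm.
have mkn : measurable_fun setT
    (fun v : 'rV[R]_p => (k v * \sum_i `|v ord0 i|)%:E).
  apply/measurable_EFinP; apply: measurable_funM => //.
  apply: measurable_sum => i; apply: measurableT_comp => //.
  exact: measurable_rV_coord.
have mkE : measurable_fun setT (fun v : 'rV[R]_p => (k v)%:E).
  exact/measurable_EFinP.
have intC : (\int[lebesgue_rV p]_v
    ((L * l * h)%:E * (k v * \sum_i `|v ord0 i|)%:E) = (C * h)%:E)%E.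
  rewrite ge0_integralZl//; last 2 first.
  - by move=> v _; rewrite lee_fin.
  - by rewrite lee_fin !mulr_ge0// ltW.
  by rewrite m1E -EFinM /C mulrAC.
(* The kernel has total mass 1, so averaging the constant [a] returns it. *)
have inta : (\int[lebesgue_rV p]_v ((k v)%:E * a%:E) = a%:E)%E.
  by rewrite ge0_integralZr ?integral_NW_kernel ?mul1e ?lee_fin.
have c0 v : (0 <= (L * l * h)%:E * (k v * \sum_i `|v ord0 i|)%:E)%E.
  by rewrite mule_ge0// lee_fin// !mulr_ge0// ltW.
have Jle : (J <= (a + C * h)%:E)%E.
  rewrite EFinD -inta -intC -ge0_integralD//; last 3 first.
  - by move=> v _; exact: mule_ge0.
  - by apply: emeasurable_funM.
  - exact: measurable_funeM.
  apply: ge0_le_integral => //.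
  - by move=> v _; exact: mule_ge0.
  - exact: emeasurable_funM.
  - apply: emeasurable_funD; first exact: emeasurable_funM.
    exact: measurable_funeM.
  move=> v _; apply: (@le_trans _ _
      ((k v)%:E * (a%:E + (L * l * (h * \sum_i `|v ord0 i|))%:E))%E).
    by rewrite lee_wpmul2l ?lee_fin// -aE -n1E G_lipschitz.
  rewrite -?EFinM -?EFinD -?EFinM lee_fin le_eqVlt; apply/orP; left; apply/eqP; ring.
have J0 : (0 <= J)%E by apply: integral_ge0 => v _; exact: mule_ge0.
(* The lower bound, by the Lipschitz estimate with its two points exchanged. *)
have ale : (a%:E <= J + (C * h)%:E)%E.
  rewrite -[leLHS]inta -intC -ge0_integralD//; last 3 first.
  - by move=> v _; exact: mule_ge0.
  - exact: emeasurable_funM.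
  - exact: measurable_funeM.
  apply: ge0_le_integral => //.
  - by move=> v _; exact: mule_ge0.
  - exact: emeasurable_funM.
  - apply: emeasurable_funD; first exact: emeasurable_funM.
    exact: measurable_funeM.
  move=> v _; apply: (@le_trans _ _ ((k v)%:E *
      (G phi (gamma - h *: v)%R + (L * l * (h * \sum_i `|v ord0 i|))%:E))%E).
    rewrite lee_wpmul2l ?lee_fin// -aE -n1E.
    rewrite (eq_bigr (fun i => `|gamma ord0 i - (gamma - h *: v) ord0 i|)).
      exact: G_lipschitz.
    by move=> i _; rewrite distrC.
  rewrite ge0_muleDr//; last by rewrite lee_fin !mulr_ge0 ?sumr_ge0// ltW.
  rewrite leeD2l// -!EFinM lee_fin le_eqVlt; apply/orP; left; apply/eqP; ring.
have JE : J = (fine J)%:E.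
  by rewrite fineK// ge0_fin_numE// (le_lt_trans Jle)// ltry.
exists (fine J); first by rewrite EFinM -JE.
move: Jle ale; rewrite JE -EFinD !lee_fin -/a => Jle ale.
by rewrite ler_norml; apply/andP; split; lra.
Qed.

End kernel_mean.

(** * Weak law of large numbers *)

Section bounded_random_variables.
Context {d} {Omega : measurableType d} {R : realType} (P : probability Omega R).
Implicit Types F : Omega -> R.

Lemma bounded_integrable F (c : R) : measurable_fun setT F ->
  (forall o, `|F o| <= c) -> P.-integrable setT (EFin \o F).
Proof.
move=> mF Fc; apply: (le_integrable measurableT _ _
  (finite_measure_integrable_cst P c measurableT)).
- exact/measurable_EFinP.
- by move=> o _ /=; rewrite lee_fin (le_trans (Fc o))// ler_norm.
Qed.

Lemma Rintegral_sum (I : Type) (s : seq I) (F : I -> Omega -> R) :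
  (forall i, P.-integrable setT (EFin \o F i)) ->
  \int[P]_o (\sum_(i <- s) F i o) = \sum_(i <- s) \int[P]_o F i o.
Proof.
move=> iF.
have iS r : P.-integrable setT (EFin \o (fun o => \sum_(i <- r) F i o)).
  rewrite (_ : _ \o _ = (fun o => \sum_(i <- r) (F i o)%:E)%E).
    by apply: integrable_sum => // i _; exact: iF.
  by apply/funext => o /=; rewrite sumEFin.
elim: s => [|i s IHs].
  under eq_Rintegral do rewrite big_nil.
  by rewrite big_nil Rintegral_cst// mul0r.
under eq_Rintegral do rewrite big_cons.
by rewrite RintegralD// big_cons IHs.
Qed.

Lemma markov_sqr F (c : R) : measurable_fun setT F -> 0 < c ->
  P.-integrable setT (EFin \o (fun o => F o ^+ 2)) ->
  (P [set o | (c <= `|F o|)%R] <= ((\int[P]_o (F o ^+ 2)) / c ^+ 2)%:E)%E.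
Proof.
move=> mF c0 iF2.
pose A := [set o | c <= `|F o|].
have mA : measurable A.
  rewrite -[A]setTI; apply: (measurable_fun_le (f := cst c)) => //.
  exact: measurableT_comp.
have mF2 : measurable_fun setT (fun o => (F o ^+ 2)%:E).
  by apply/measurable_EFinP; exact: measurable_funX.
have : ((c ^+ 2)%:E * P A <= \int[P]_o (F o ^+ 2)%:E)%E.
  rewrite -integral_cst//.
  apply: (@le_trans _ _ (\int[P]_(o in A) (F o ^+ 2)%:E)%E).
    apply: ge0_le_integral => //.
    - by move=> o _; rewrite lee_fin sqr_ge0.
    - exact: measurable_funTS.
    move=> o Ao; rewrite lee_fin -[leRHS]real_normK ?num_real//.
    by rewrite ler_pXn2r ?nnegrE// ltW.
  by apply: ge0_subset_integral => // o _; rewrite lee_fin sqr_ge0.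
have fi : (\int[P]_o (F o ^+ 2)%:E)%E \is a fin_num by exact: integrable_fin_num.
rewrite -[X in (_ <= X)%E]fineK// -(fineK (fin_num_measure P A mA)).
by rewrite -EFinM !lee_fin ler_pdivlMr ?exprn_gt0// mulrC.
Qed.

End bounded_random_variables.

Section iid.
Context {d d'} {Omega : measurableType d} {T : measurableType d'}
  {R : realType} (P : probability Omega R).
Variables (V : {RV P >-> T}) (S : nat -> {RV P >-> T}).
Hypotheses (hindep : mutually_independent P S)
  (hident : forall i, identically_distributed (S i) V).

(** The law of [(S i, S j)] agrees with the product law on rectangles by independence, hence
    everywhere by uniqueness of product measures. *)
Lemma independent_pair i j X : i != j -> measurable X ->
  (distribution P V \x distribution P V)%E X =
  P ((fun o => (S i o, S j o)) @^-1` X).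
Proof.
move=> ij mX.
have mphi : measurable_fun setT (fun o => (S i o, S j o)).
  by apply/measurable_fun_pairP; split; exact: measurable_funP.
pose nu :=
  measure_function_pushforward__canonical__measure_function_Measure P mphi.
rewrite -[RHS]/(nu X); apply: product_measure_unique => // A B mA mB.
rewrite -[X in _ = (X * _)%E](hident i mA) -[X in _ = (_ * X)%E](hident j mB).
have := @hindep [fset i; j]%fset (fun k => if k == i then A else B).
rewrite big_fsetU1/= ?inE// big_seq_fset1 eqxx eq_sym (negbTE ij).
move=> indep; apply: etrans (indep _); last by move=> k; case: ifP.
  congr (P _); apply/seteqP; split => [w [/= Aw Bw] k|w H].
    by rewrite /= !inE => /orP[] /eqP ->; rewrite ?eqxx// eq_sym (negbTE ij).
  split => /=.
    by have := H i; rewrite /= !inE !eqxx; apply.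
  by have := H j; rewrite /= !inE eqxx orbT eq_sym (negbTE ij); apply.
Qed.

Variables (psi : T -> R) (B : R).
Hypotheses (mpsi : measurable_fun setT psi) (psi0 : forall t, 0 <= psi t)
  (psiB : forall t, psi t <= B).

Let m := \int[P]_o psi (V o).

Let B0 : 0 <= B.
Proof. exact: le_trans (psi0 (V point)) (psiB _). Qed.

Let mY i : measurable_fun setT (fun o => psi (S i o)).
Proof. exact: (measurableT_comp mpsi (measurable_funP (S i))). Qed.

Let psi_norm t : `|psi t| <= B. Proof. by rewrite ger0_norm. Qed.

Let iY i : P.-integrable setT (EFin \o (fun o => psi (S i o))).
Proof. exact: bounded_integrable (mY i) _. Qed.

Let iYY i j : P.-integrable setT (EFin \o (fun o => psi (S i o) * psi (S j o))).
Proof.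
apply: (@bounded_integrable _ _ _ _ _ (B * B)).
  exact: measurable_funM.
by move=> o; rewrite normrM ler_pM.
Qed.

Let law_mean : (\int[distribution P V]_t (psi t)%:E = m%:E)%E.
Proof.
rewrite /m /Rintegral fineK; last first.
  apply: integrable_fin_num => //; apply: bounded_integrable => //.
  exact: (measurableT_comp mpsi (measurable_funP V)).
rewrite [LHS](ge0_integral_pushforward (measurable_funP V)); last 3 first.
- by [].
- exact/measurable_EFinP.
- by move=> t _; rewrite lee_fin.
by rewrite preimage_setT.
Qed.

Let mean i : \int[P]_o psi (S i o) = m.
Proof.
apply: EFin_inj; rewrite -law_mean /Rintegral fineK; last first.
  by apply: integrable_fin_num => //; exact: iY.
transitivity (\int[distribution P (S i)]_t (psi t)%:E)%E.
  rewrite [RHS](ge0_integral_pushforward (measurable_funP (S i))); last 3 first.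
  - by [].
  - exact/measurable_EFinP.
  - by move=> t _; rewrite lee_fin.
  by rewrite preimage_setT.
by apply: eq_measure_integral => A mA _; exact: hident.
Qed.

(** Under the product law of two distinct observations, Tonelli's theorem factors the integral. *)
Let mean_prod i j : i != j -> \int[P]_o (psi (S i o) * psi (S j o)) = m ^+ 2.
Proof.
move=> ij; apply: EFin_inj; rewrite /Rintegral fineK; last first.
  by apply: integrable_fin_num => //; exact: iYY.
have mphi : measurable_fun setT (fun o => (S i o, S j o)).
  by apply/measurable_fun_pairP; split; exact: measurable_funP.
pose F (z : T * T) := (psi z.1 * psi z.2)%:E.
have mF : measurable_fun setT F.
  apply/measurable_EFinP; apply: measurable_funM; exact: measurableT_comp.
have F0 z : (0 <= F z)%E by rewrite lee_fin mulr_ge0.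
transitivity (\int[(distribution P V \x distribution P V)%E]_z F z)%E.
  have := ge0_integral_pushforward mphi P measurableT mF (fun x _ => F0 x).
  rewrite preimage_setT => <-; apply: eq_measure_integral => A mA _.
  exact/esym/independent_pair.
rewrite fubini_tonelli1//.
transitivity (\int[distribution P V]_t ((psi t)%:E * m%:E))%E.
  apply: eq_integral => t _; rewrite /fubini_F /F.
  under eq_integral do rewrite /= EFinM.
  rewrite ge0_integralZl ?lee_fin ?law_mean//; first exact/measurable_EFinP.
  by move=> *; rewrite lee_fin.
rewrite ge0_integralZr//; last 3 first.
- exact/measurable_EFinP.
- by move=> *; rewrite lee_fin.
- by rewrite -law_mean; apply: integral_ge0 => *; rewrite lee_fin.
by rewrite law_mean -EFinM.
Qed.

(** Bounding only one of the two factors by [B] keeps [m]. For the kernel [m] is of order [h ^+ p],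
    which is what makes the variance [O(1 / (n h ^ p))] rather than [O(1 / (n h ^ (2 p)))]. *)
Let second_moment i : \int[P]_o (psi (S i o) * psi (S i o)) <= B * m.
Proof.
rewrite -(mean i) -RintegralZl//; apply: le_Rintegral => //.
  apply: (@bounded_integrable _ _ _ _ _ (B * B)); first exact: measurable_funM.
  by move=> o; rewrite normrM ler_pM// ger0_norm.
by move=> o _; rewrite ler_wpM2r.
Qed.

(** Chebyshev's inequality for the centred sum, whose variance is at most [n * B * m]. *)
Lemma iid_weak_law n (a : R) : (0 < n)%N -> 0 < a ->
  (P [set o | (n%:R * a <= `|\sum_(i < n) psi (S i o) - n%:R * m|)%R] <=
   (B * m / (n%:R * a ^+ 2))%:E)%E.
Proof.
move=> n0 a0; have nR : 0 < n%:R :> R by rewrite ltr0n.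
pose D i o := psi (S i o) - m.
have mD i : measurable_fun setT (D i) by exact: measurable_funB.
have D_le i o : `|D i o| <= B + `|m|.
  by rewrite (le_trans (ler_normB _ _))// lerD2r.
have iDD i j : P.-integrable setT (EFin \o (fun o => D i o * D j o)).
  apply: (@bounded_integrable _ _ _ _ _ ((B + `|m|) * (B + `|m|))).
    exact: measurable_funM.
  by move=> o; rewrite normrM ler_pM.
have cov i j : \int[P]_o (D i o * D j o) =
    \int[P]_o (psi (S i o) * psi (S j o)) - m ^+ 2.
  have -> : \int[P]_o (D i o * D j o) = \int[P]_o ((psi (S i o) * psi (S j o)
      - m * psi (S i o)) - (m * psi (S j o) - m ^+ 2)).
    by apply: eq_Rintegral => o _; rewrite /D; ring.
  have iZ k : P.-integrable setT (EFin \o (fun o => m * psi (S k o))).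
    apply: (@bounded_integrable _ _ _ _ _ (`|m| * B)).
      exact: measurable_funM.
    by move=> o; rewrite normrM ler_wpM2l.
  have ic : P.-integrable setT (EFin \o (fun o : Omega => m ^+ 2)).
    exact: finite_measure_integrable_cst.
  rewrite RintegralB//; last 2 first.
  - exact: integrableB (iYY i j) (iZ i).
  - exact: integrableB (iZ j) ic.
  have Z k : \int[P]_o (m * psi (S k o)) = m * m by rewrite RintegralZl// mean.
  rewrite RintegralB// RintegralB// !Z Rintegral_cst//.
  rewrite [X in fine X]probability_setT/= mulr1.
  by ring.
pose T_ o := \sum_(i < n) D i o.
have TE o : T_ o = \sum_(i < n) psi (S i o) - n%:R * m.
  by rewrite /T_ sumrB sumr_const card_ord mulr_natl.
under eq_set do rewrite -TE.
have T2E : (fun o => T_ o ^+ 2) = (fun o => \sum_(i < n) \sum_(j < n) D i o * D j o).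
  by apply/funext => o; rewrite expr2 /T_ big_distrlr.
have mT : measurable_fun setT T_ by exact: measurable_sum.
have T_le o : `|T_ o| <= n%:R * (B + `|m|).
  rewrite (le_trans (ler_norm_sum _ _ _))//.
  rewrite -[n in leRHS]card_ord mulr_natl -sumr_const.
  exact: ler_sum.
have iT2 : P.-integrable setT (EFin \o (fun o => T_ o ^+ 2)).
  apply: (@bounded_integrable _ _ _ _ _ ((n%:R * (B + `|m|)) ^+ 2)).
    exact: measurable_funX.
  by move=> o; rewrite normrX ler_pXn2r ?nnegrE// mulr_ge0// addr_ge0.
(* Expanding the square leaves only the diagonal, since distinct observations are uncorrelated. *)
have ET2 : \int[P]_o (T_ o ^+ 2) <= n%:R * (B * m).
  rewrite T2E Rintegral_sum; last first.
    move=> i; rewrite (_ : _ \o _ = (fun o => \sum_(j < n) (D i o * D j o)%:E)%E).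
      by apply: integrable_sum => // j _; exact: iDD.
    by apply/funext => o /=; rewrite sumEFin.
  rewrite -[n in leRHS]card_ord mulr_natl -sumr_const; apply: ler_sum => i _.
  rewrite Rintegral_sum// (bigD1 i)//= big1 ?addr0; last first.
    by move=> j ji; rewrite cov mean_prod ?subrr// eq_sym.
  by rewrite cov (le_trans _ (second_moment i))// gerBl sqr_ge0.
have na0 : 0 < n%:R * a by rewrite mulr_gt0.
apply: le_trans (markov_sqr mT na0 iT2) _; rewrite lee_fin.
rewrite ler_pdivrMr ?exprn_gt0// (le_trans ET2)//.
rewrite le_eqVlt; apply/orP; left; apply/eqP; field.
by rewrite !gt_eqF.
Qed.

End iid.

(** * Worst-case expectation over the ambiguity set *)

Section dirac_mixture.
Context {d} {T : measurableType d} {R : realType} {n : nat}.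
Variables (w : 'I_n -> R) (a : 'I_n -> T).
Hypothesis w0 : forall i, 0 <= w i.

(** [msum] takes measures indexed by [nat], hence [insub]; the [mzero] branch is never reached for
    indices below [n]. In this form the measure structure is inherited. *)
Definition dirac_mixture : set T -> \bar R :=
  msum (fun k : nat =>
    if insub k is Some i then mscale (NngNum (w0 i)) \d_(a i) else mzero) n.

HB.instance Definition _ := Measure.on dirac_mixture.

Lemma dirac_mixtureE A :
  dirac_mixture A = (\sum_i (w i)%:E * \d_(a i) A)%E.
Proof. by rewrite /dirac_mixture/= /msum; apply: eq_bigr => i _; rewrite valK. Qed.

Lemma ge0_integral_dirac_mixture (f : T -> \bar R) : measurable_fun setT f ->
  (forall t, 0 <= f t)%E ->
  (\int[dirac_mixture]_t f t = \sum_i (w i)%:E * f (a i))%E.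
Proof.
move=> mf f0; rewrite ge0_integral_measure_sum//; apply: eq_bigr => i _.
by rewrite valK ge0_integral_mscale// integral_dirac// diracT mul1e.
Qed.

(** The function may change sign, so the nonnegative case is applied to its positive and negative
    parts, whose integrals are finite sums of reals. *)
Lemma integral_dirac_mixture (mu : {measure set T -> \bar R}) (f : T -> R) :
  (forall A, measurable A -> mu A = (\sum_i (w i)%:E * \d_(a i) A)%E) ->
  measurable_fun setT f ->
  (\int[mu]_t (f t)%:E = (\sum_i w i * f (a i))%:E)%E.
Proof.
move=> muE mf.
rewrite (eq_measure_integral dirac_mixture); last first.
  by move=> A mA _; apply: etrans (muE A mA) _; exact/esym/dirac_mixtureE.
have mEf : measurable_fun setT (EFin \o f) by exact/measurable_EFinP.
rewrite integralE !ge0_integral_dirac_mixture//; last 2 first.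
- exact: measurable_funeneg.
- exact: measurable_funepos.
rewrite -[RHS]sumEFin.
under eq_bigr do rewrite funeposE -EFin_max -EFinM.
under [X in (_ - X)%E]eq_bigr do rewrite funenegE -EFinN -EFin_max -EFinM.
rewrite !sumEFin -EFinB -sumrB; congr EFin; apply: eq_bigr => i _.
rewrite -mulrBr; congr (_ * _).
by rewrite /Order.max; case: ltP => ?; case: ltP => ?; lra.
Qed.

End dirac_mixture.

Section robust_expectation.
Context {R : realType} {p q n : nat}.
Variables (gamma : 'rV[R]_p) (bw : R) (data : 'I_n -> 'rV[R]_p * 'rV[R]_q).
Hypothesis n0 : (0 < n)%N.

Let wbar := NW_weight gamma bw data.

Lemma NW_kernel_sum_gt0 :
  0 < \sum_j NW_kernel (bw^-1 *: (gamma - (data j).1)).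
Proof.
rewrite (bigD1 (Ordinal n0))//= ltr_pwDl ?NW_kernel_gt0// sumr_ge0// => i _.
by rewrite ltW// NW_kernel_gt0.
Qed.

Lemma NW_weight_gt0 i : 0 < wbar i.
Proof. by rewrite divr_gt0 ?NW_kernel_gt0 ?NW_kernel_sum_gt0. Qed.

Lemma NW_weight_sum : \sum_i wbar i = 1.
Proof. by rewrite -mulr_suml divff// gt_eqF// NW_kernel_sum_gt0. Qed.

Lemma robust_expectationE (lambda : R) (phi : 'rV[R]_q -> R) :
  measurable_fun setT phi -> (forall i, 0 <= phi (data i).2 <= 1) ->
  0 <= lambda <= Num.sqrt (NW_variance gamma bw data phi) ->
  is_max [set (\int[Q]_xi (phi xi)%:E)%E |
           Q in ambiguity_set gamma bw data lambda]
    (NW_expectation gamma bw data phi +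
     lambda * Num.sqrt (NW_variance gamma bw data phi))%:E.
Proof.
move=> mphi phi01 l01.
have wb0 := NW_weight_gt0; have wb1 := NW_weight_sum.
(* The factor 1/2 of the divergence cancels that of the radius. *)
have chi2E v : (chi2_divergence gamma bw data v <= lambda ^+ 2 / 2) =
    (\sum_i (v i - wbar i) ^+ 2 / wbar i <= lambda ^+ 2).
  by rewrite /chi2_divergence mulrC ler_pM2r// invr_gt0.
split.
  have [v [v0 v1 vchi vE]] := chi2_ball_attained wb0 wb1 phi01 l01.
  have QT : dirac_mixture (fun i => (data i).2) v0 [set: 'rV[R]_q] = 1%E.
    rewrite dirac_mixtureE; under eq_bigr do rewrite diracT mule1.
    by rewrite sumEFin v1.
  pose Q : probability 'rV[R]_q R :=
    HB.pack (dirac_mixture (fun i => (data i).2) v0)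
      (Measure_isProbability.Build _ _ _ _ QT).
  exists Q.
    exists v; split => //; first by rewrite chi2E.
    by move=> A _; exact: dirac_mixtureE.
  rewrite (integral_dirac_mixture v0 (a := fun i => (data i).2))//; last first.
    by move=> A _; exact: dirac_mixtureE.
  by congr EFin; exact: vE.
(* The bound for every member of the ambiguity set; the case above exhibits the maximiser. *)
move=> _ [Q [v [[v0 v1] vchi QE]] <-].
rewrite (integral_dirac_mixture v0 (a := fun i => (data i).2))// lee_fin.
apply: (chi2_ball_le (phi \o snd \o data) wb0 wb1 v1); last by rewrite -chi2E.
by case/andP: l01.
Qed.

End robust_expectation.

(** * Consistency of the Nadaraya-Watson variance *)

Section with_high_probability.
Context {d} {Omega : measurableType d} {R : realType} (P : probability Omega R).
Implicit Types Q : nat -> Omega -> Prop.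

(* [Q n] holds with probability tending to 1.  The exceptional set is measurable,
   [Q n] itself need not be. *)
Definition whp Q := forall e : R, 0 < e -> \forall n \near \oo,
  exists N, [/\ measurable N, (P N <= e%:E)%E & forall o, ~ N o -> Q n o].

Lemma whp_sub Q Q' : (\forall n \near \oo, forall o, Q n o -> Q' n o) ->
  whp Q -> whp Q'.
Proof.
move=> QQ' hQ e e0; near=> n.
have [N [mN Ne NQ]] : exists N, [/\ measurable N, (P N <= e%:E)%E &
  forall o, ~ N o -> Q n o] by near: n; exact: hQ.
exists N; split => // o /NQ; have : forall o, Q n o -> Q' n o by near: n.
exact.
Unshelve. all: by end_near. Qed.

Lemma whp_and Q Q' : whp Q -> whp Q' -> whp (fun n o => Q n o /\ Q' n o).
Proof.
move=> hQ hQ' e e0; have e2 : 0 < e / 2 by rewrite divr_gt0.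
near=> n.
have [N [mN Ne NQ]] : exists N, [/\ measurable N, (P N <= (e / 2)%:E)%E &
  forall o, ~ N o -> Q n o] by near: n; exact: hQ.
have [N' [mN' Ne' NQ']] : exists N, [/\ measurable N, (P N <= (e / 2)%:E)%E &
  forall o, ~ N o -> Q' n o] by near: n; exact: hQ'.
exists (N `|` N'); split => [||o /not_orP[/NQ ? /NQ' ?]]//.
  exact: measurableU.
by rewrite (le_trans (measureU2 P mN mN'))// [e]splitr EFinD leeD.
Unshelve. all: by end_near. Qed.

Lemma whp_all (I : eqType) (s : seq I) (Q : I -> nat -> Omega -> Prop) :
  (forall i, i \in s -> whp (Q i)) ->
  whp (fun n o => forall i, i \in s -> Q i n o).
Proof.
elim: s => [_ e e0|i s IHs Qs].
  by apply: nearW => n; exists set0; split=> //; rewrite measure0 lee_fin ltW.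
apply: (@whp_sub (fun n o => Q i n o /\ forall i, i \in s -> Q i n o)).
  apply: nearW => n o [Qi Qs'] j; rewrite inE => /orP[/eqP->//|]; exact: Qs'.
apply: whp_and; first by apply: Qs; rewrite mem_head.
by apply: IHs => j js; apply: Qs; rewrite inE js orbT.
Qed.

End with_high_probability.

(** The tolerance [m / 2] keeps [x] above [m / 2], and [m * t / 12] then puts each ratio within
    [t / 3] of its limit. Squaring a ratio in [[0, 1]] at most doubles the error, so the total is
    [t / 3 + 2 * (t / 3) = t]. *)
Lemma ratio_variance_close (R : realType) (m a1 a2 x y z t : R) :
  0 < m -> 0 < t -> 0 <= a1 <= m -> 0 <= a2 <= m -> 0 <= y <= x ->
  `|x - m| < Num.min (m / 2) (m * t / 12) ->
  `|y - a1| < Num.min (m / 2) (m * t / 12) ->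
  `|z - a2| < Num.min (m / 2) (m * t / 12) ->
  a2 / m - (a1 / m) ^+ 2 <= z / x - (y / x) ^+ 2 + t.
Proof.
move=> m0 t0 /andP[a10 a1m] /andP[a20 a2m] /andP[y0 yx].
rewrite !lt_min !ltr_distl.
move=> /andP[/andP[x1 x2] /andP[x3 x4]] /andP[_ /andP[y1 y2]].
move=> /andP[_ /andP[z1 z2]].
have x0 : 0 < x by lra.
have sandwich (u b : R) : b <= m -> 0 <= b ->
    b - m * t / 12 < u < b + m * t / 12 -> `|u / x - b / m| <= t / 3.
  move=> bm b0 /andP[u1 u2].
  have -> : u / x - b / m = ((u - b) * m - b * (x - m)) / (x * m).
    by field; rewrite !gt_eqF.
  rewrite normrM normfV (gtr0_norm (mulr_gt0 x0 m0)) ler_pdivrMr ?mulr_gt0//.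
  rewrite (le_trans (ler_normB _ _))// !normrM (gtr0_norm m0) (ger0_norm b0).
  have k1 : `|u - b| <= m * t / 12 by rewrite ler_distl; apply/andP; split; lra.
  have k2 : `|x - m| <= m * t / 12 by rewrite ler_distl; apply/andP; split; lra.
  apply: (@le_trans _ _ (m * t / 12 * m + m * (m * t / 12))).
    by apply: lerD; [rewrite ler_wpM2r// ltW|rewrite ler_pM].
  have : t * m * (m / 2) <= t * m * x by rewrite ler_wpM2l ?mulr_ge0 ?ltW//; lra.
  by nra.
have := sandwich z a2 a2m a20; rewrite z1 z2 => /(_ isT).
have := sandwich y a1 a1m a10; rewrite y1 y2 => /(_ isT).
rewrite !ler_distl => /andP[e1 e2] /andP[e3 e4].
have u0 : 0 <= y / x by rewrite divr_ge0// ltW.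
have u1 : y / x <= 1 by rewrite ler_pdivrMr// mul1r.
have v0 : 0 <= a1 / m by rewrite divr_ge0// ltW.
have v1 : a1 / m <= 1 by rewrite ler_pdivrMr// mul1r.
have : (y / x) ^+ 2 <= (a1 / m) ^+ 2 + 2 * (t / 3).
  move: e1 e2 u0 u1 v0 v1; set u := y / x; set v := a1 / m => e1 e2 u0 u1 v0 v1.
  have -> : u ^+ 2 = v ^+ 2 + (u - v) * (u + v) by ring.
  rewrite lerD2l; have [uv|uv] := leP u v.
    by rewrite (@le_trans _ _ 0)// ?mulr_le0_ge0 ?subr_le0 ?addr_ge0//; lra.
  rewrite mulrC; apply: ler_pM; lra.
by lra.
Qed.

Section nadaraya_watson_consistency.
Context {R : realType} {p q : nat} {d} {Omega : measurableType d}.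
Variable P : probability Omega R.
Variables (V : {RV P >-> ('rV[R]_p * 'rV[R]_q)%type})
  (S : nat -> {RV P >-> ('rV[R]_p * 'rV[R]_q)%type})
  (f : 'rV[R]_p * 'rV[R]_q -> R) (gamma : 'rV[R]_p) (h : nat -> R)
  (L : R) (Xi : set 'rV[R]_q).
Hypotheses (hf : has_density (distribution P V) f)
  (hindep : mutually_independent P S)
  (hident : forall i, identically_distributed (S i) V).
Hypotheses (hpos : forall n, 0 < h n) (h0 : h @ \oo --> 0)
  (hinf : (fun n => n%:R * h n ^+ p) @ \oo --> +oo).
Hypothesis L0 : 0 <= L.
Hypothesis fL : forall u u' xi,
  `|f (u, xi) - f (u', xi)| <= L * \sum_i `|u ord0 i - u' ord0 i|.
Hypotheses (mXi : measurable Xi) (Xioo : (lebesgue_rV q Xi < +oo)%E).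
Hypothesis fXi : forall u xi, ~ Xi xi -> f (u, xi) = 0.
Hypothesis foo : (\int[lebesgue_rV q]_xi (f (gamma, xi))%:E < +oo)%E.

Let psi (b : R) (phi : 'rV[R]_q -> R) (z : 'rV[R]_p * 'rV[R]_q) : R :=
  NW_kernel (b^-1 *: (gamma - z.1)) * phi z.2.

(** Estimator of the integral of [phi] against [f (gamma, _)]; for [phi = cst 1] it is the kernel
    estimate of the marginal density. *)
Definition kernel_average (phi : 'rV[R]_q -> R) n (o : Omega) : R :=
  (n%:R * h n ^+ p)^-1 * \sum_(i < n) psi (h n) phi (S i o).

Let a (phi : 'rV[R]_q -> R) : R :=
  \int[lebesgue_rV q]_xi (phi xi * f (gamma, xi)).

Let measurable_psi b (phi : 'rV[R]_q -> R) : measurable_fun setT phi ->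
  measurable_fun setT (psi b phi).
Proof.
move=> mphi; apply: measurable_funM; last exact: measurableT_comp.
rewrite (_ : (fun _ => _) = @NW_kernel R p \o
    (fun v : 'rV[R]_p => b^-1 *: gamma - b^-1 *: v) \o fst).
  apply: measurableT_comp => //; apply: measurableT_comp => //.
    exact: measurable_NW_kernel.
  exact: measurable_rV_affine.
by apply/funext => z /=; rewrite scalerBr.
Qed.

Let a_ge0 phi : (forall xi, 0 <= phi xi <= 1) -> 0 <= a phi.
Proof.
move=> phi01; apply: Rintegral_ge0 => xi _; rewrite mulr_ge0//.
  by case/andP: (phi01 xi).
by case: hf.
Qed.

(** The tolerance [k] is shared equally between the bias, from [kernel_mean], and the random
    deviation, from [iid_weak_law]. *)
Lemma kernel_average_consistent (phi : 'rV[R]_q -> R) (k : R) : 0 < k ->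
  measurable_fun setT phi -> (forall xi, 0 <= phi xi <= 1) ->
  whp P (fun n o => `|kernel_average phi n o - a phi| < k).
Proof.
move=> k0 mphi phi01 e e0; have [f0 mf fE] := hf.
have p0 xi : 0 <= phi xi by case/andP: (phi01 xi).
have [C C0 HC] := kernel_mean f0 mf L0 fL mXi Xioo fXi foo.
pose B : R := (@kernel_cst R p)^-1.
have B0 : 0 <= B by rewrite invr_ge0 ltW// kernel_cst_gt0.
have ap := a_ge0 phi01.
(* The Chebyshev bound is [4 * B * r / (n h ^ p k ^ 2)] with [r <= a phi + k], so [c <= n h ^ p]
   makes it at most [e]. *)
pose c : R := B * (a phi + k) * 4 / (e * k ^+ 2).
near=> n.
have n0 : (0 < n)%N by near: n; exact: nbhs_infty_gt.
have nR : 0 < n%:R :> R by rewrite ltr0n.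
have hp0 : 0 < h n ^+ p by rewrite exprn_gt0.
have Ch : C * h n <= k / 2.
  (* [C + 1] is used because [C] may be 0. *)
  have : `|0 - h n| < k / 2 / (C + 1).
    near: n; move/cvgrPdist_lt : h0; apply; rewrite !divr_gt0//.
    by rewrite ltr_wpDl.
  rewrite sub0r normrN gtr0_norm// ltr_pdivlMr ?ltr_wpDl// => hC.
  by have := hpos n; nra.
have nh : c <= n%:R * h n ^+ p by near: n; apply/(cvgryPge _).1.
have [r rE ra] := HC (h n) phi (hpos n) mphi phi01.
have mpsi := measurable_psi (h n) mphi.
have psi0 z : 0 <= psi (h n) phi z by rewrite mulr_ge0// ltW// NW_kernel_gt0.
have psiB z : psi (h n) phi z <= B.
  rewrite /psi (le_trans _ (NW_kernel_le ((h n)^-1 *: (gamma - z.1))))//.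
  by rewrite ler_piMr ?(ltW (NW_kernel_gt0 _))//; case/andP: (phi01 z.2).
have mE : \int[P]_o psi (h n) phi (V o) = h n ^+ p * r.
  have mEpsi : measurable_fun setT (fun z => (psi (h n) phi z)%:E).
    exact/measurable_EFinP.
  have Epsi0 z : (0 <= (psi (h n) phi z)%:E)%E by rewrite lee_fin.
  have dE := integral_density_prod f0 mf fE mEpsi Epsi0.
  have {dE}rE := etrans dE rE.
  have := ge0_integral_pushforward (measurable_funP V) P measurableT mEpsi
    (fun z _ => Epsi0 z).
  by rewrite preimage_setT /Rintegral [LHS]rE => <-.
have hk0 : 0 < h n ^+ p * (k / 2) by rewrite mulr_gt0// divr_gt0.
have := iid_weak_law hindep hident mpsi psi0 psiB n0 hk0; rewrite mE => PN.
exists [set o | n%:R * (h n ^+ p * (k / 2)) <=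
  `|\sum_(i < n) psi (h n) phi (S i o) - n%:R * (h n ^+ p * r)|]; split.
- rewrite -[X in measurable X]setTI.
  apply: (measurable_fun_le (f := cst (n%:R * (h n ^+ p * (k / 2))))) => //.
  apply: measurableT_comp => //; apply: measurable_funB => //.
  apply: measurable_sum => i.
  exact: (measurableT_comp mpsi (measurable_funP (S i))).
- apply: le_trans PN _; rewrite lee_fin ler_pdivrMr; last first.
    by rewrite mulr_gt0// exprn_gt0.
  have rk : r <= a phi + k.
    by move: ra; rewrite -/(a phi) ler_distl => /andP[_]; lra.
  have : c * (e * k ^+ 2) <= n%:R * h n ^+ p * (e * k ^+ 2).
    by rewrite ler_pM2r// mulr_gt0// exprn_gt0.
  rewrite {1}/c divfK ?gt_eqF ?mulr_gt0 ?exprn_gt0// => cn.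
  have : B * r <= B * (a phi + k) by rewrite ler_wpM2l.
  move=> Br; have {cn}Br : B * r <= n%:R * h n ^+ p * (e * k ^+ 2) / 4 by lra.
  rewrite (_ : e * _ = h n ^+ p * (n%:R * h n ^+ p * (e * k ^+ 2) / 4)); last first.
    by field.
  by rewrite mulrCA ler_pM2l.
- move=> o /= /negP; rewrite -ltNge => Sk.
  have avgE : kernel_average phi n o - r =
      (\sum_(i < n) psi (h n) phi (S i o) - n%:R * (h n ^+ p * r)) /
      (n%:R * h n ^+ p).
    by rewrite /kernel_average; field; rewrite !gt_eqF.
  have : `|kernel_average phi n o - r| < k / 2.
    rewrite avgE normrM normfV (gtr0_norm (mulr_gt0 nR hp0)).
    by rewrite ltr_pdivrMr ?mulr_gt0// [ltRHS]mulrC -mulrA.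
  move=> ar; rewrite [k]splitr; apply: (le_lt_trans (ler_distD r _ _)).
  by apply: ltr_leD => //; exact: le_trans ra Ch.
Unshelve. all: by end_near. Qed.

Hypothesis hgamma : marginal_density f gamma != 0.

Lemma cond_varianceE (phi : 'rV[R]_q -> R) : measurable_fun setT phi ->
  (forall xi, 0 <= phi xi <= 1) ->
  cond_variance f gamma phi =
  a (fun xi => phi xi ^+ 2) / a (cst 1) - (a phi / a (cst 1)) ^+ 2.
Proof.
move=> mphi phi01; have [f0 mf _] := hf.
have aE : a (cst 1) = marginal_density f gamma.
  by apply: eq_Rintegral => xi _; rewrite mul1r.
have m0 := hgamma; set m := marginal_density f gamma in m0 aE *; rewrite aE.
have mfg : measurable_fun setT (fun xi => f (gamma, xi)).
  exact: (measurableT_comp mf (pair1_measurable gamma)).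
have intb (b : 'rV[R]_q -> R) : measurable_fun setT b ->
    (forall xi, 0 <= b xi <= 1) ->
    (lebesgue_rV q).-integrable setT (EFin \o (fun xi => b xi * f (gamma, xi))).
  move=> mb b01; have b0 xi : 0 <= b xi by case/andP: (b01 xi).
  apply: (@le_integrable _ _ _ _ _ measurableT _ (fun xi => (f (gamma, xi))%:E)).
  - by apply/measurable_EFinP; exact: measurable_funM.
  - move=> xi _ /=; rewrite lee_fin normrM ler_piMl// ger0_norm//.
    by case/andP: (b01 xi).
  - apply/integrableP; split; first exact/measurable_EFinP.
    rewrite (eq_integral (fun xi => (f (gamma, xi))%:E))// => xi _ /=.
    by rewrite ger0_norm.
have i1 : (lebesgue_rV q).-integrable setT (EFin \o (fun xi => f (gamma, xi))).
  rewrite (_ : _ \o _ = EFin \o (fun xi => cst 1 xi * f (gamma, xi))).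
    by apply: intb => // xi; rewrite ler01 lexx.
  by apply/funext => xi /=; rewrite mul1r.
have phi2 xi : 0 <= phi xi ^+ 2 <= 1.
  by have /andP[x0 x1] := phi01 xi; rewrite sqr_ge0 expr_le1.
have ce (b : 'rV[R]_q -> R) : measurable_fun setT b ->
    (forall xi, 0 <= b xi <= 1) -> cond_expectation f gamma b = a b / m.
  move=> mb b01; rewrite /a mulrC -RintegralZl//; last exact: intb.
  by apply: eq_Rintegral => xi _; rewrite -/m; ring.
rewrite /cond_variance (ce phi)//; set u := a phi / m.
transitivity (\int[lebesgue_rV q]_xi (m^-1 * (phi xi ^+ 2 * f (gamma, xi)) -
    (2 * u / m * (phi xi * f (gamma, xi)) - u ^+ 2 / m * f (gamma, xi)))).
  by apply: eq_Rintegral => xi _; rewrite -/m; ring.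
have mphi2 : measurable_fun setT (fun xi => phi xi ^+ 2).
  exact: measurable_funX.
have iZ (b : 'rV[R]_q -> R) (r : R) :
    (lebesgue_rV q).-integrable setT (EFin \o b) ->
    (lebesgue_rV q).-integrable setT (EFin \o (fun xi => r * b xi)).
  move=> ib; rewrite (_ : _ \o _ = (fun xi => r%:E * (EFin \o b) xi)%E).
    exact: integrableZl.
  by apply/funext.
have ip := intb _ mphi phi01; have ip2 := intb _ mphi2 phi2.
rewrite RintegralB//; last 2 first.
- exact: iZ ip2.
- exact: integrableB (iZ _ _ ip) (iZ _ _ i1).
rewrite (RintegralZl _ measurableT ip2).
rewrite RintegralB//; last 2 first.
- exact: iZ ip.
- exact: iZ i1.
rewrite (RintegralZl _ measurableT ip) (RintegralZl _ measurableT i1).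
rewrite -/(a phi) -/(marginal_density f gamma) -/m -/(a _) /u.
by field.
Qed.

Lemma NW_expectationE (phi : 'rV[R]_q -> R) n o : (0 < n)%N ->
  NW_expectation gamma (h n) (fun i : 'I_n => S i o) phi =
  kernel_average phi n o / kernel_average (cst 1) n o.
Proof.
move=> n0; have nR : n%:R != 0 :> R by rewrite pnatr_eq0 -lt0n.
have hn : h n ^+ p != 0 by rewrite expf_neq0// gt_eqF.
have K0 := NW_kernel_sum_gt0 gamma (h n) (fun i : 'I_n => S i o) n0.
have -> : kernel_average (cst 1) n o = (n%:R * h n ^+ p)^-1 *
    \sum_(i < n) NW_kernel ((h n)^-1 *: (gamma - (S i o).1)).
  by congr (_ * _); apply: eq_bigr => i _; rewrite /psi /= mulr1.
rewrite /NW_expectation /NW_weight.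
under eq_bigr do rewrite mulrAC.
rewrite -mulr_suml /kernel_average; field.
by rewrite hn nR gt_eqF.
Qed.

(** Both variances are the same function of three kernel averages or of their limits, those of [1],
    [phi] and [phi ^+ 2], so consistency of the averages suffices. *)
Lemma NW_variance_consistent (phi : 'rV[R]_q -> R) (t : R) : 0 < t ->
  measurable_fun setT phi -> (forall xi, 0 <= phi xi <= 1) ->
  whp P (fun n o => Num.sqrt (cond_variance f gamma phi) <=
    Num.sqrt (NW_variance gamma (h n) (fun i : 'I_n => S i o) phi) + t).
Proof.
move=> t0 mphi phi01; have [f0 mf _] := hf.
have m_gt0 : 0 < a (cst 1).
  have -> : a (cst 1) = marginal_density f gamma.
    by apply: eq_Rintegral => xi _; rewrite mul1r.
  by rewrite lt_def hgamma; apply: Rintegral_ge0.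
have phi2 xi : 0 <= phi xi ^+ 2 <= 1.
  by have /andP[x0 x1] := phi01 xi; rewrite sqr_ge0 expr_le1.
have mphi2 : measurable_fun setT (fun xi => phi xi ^+ 2).
  exact: measurable_funX.
have c01 (xi : 'rV[R]_q) : 0 <= cst (1 : R) xi <= 1 by rewrite ler01 lexx.
set m := a (cst 1) in m_gt0.
(* The variances are compared up to [t ^+ 2], because the square root of [v + t ^+ 2] is at most
   [Num.sqrt v + t]. *)
pose k := Num.min (m / 2) (m * t ^+ 2 / 12).
have k0 : 0 < k by rewrite lt_min !divr_gt0// mulr_gt0// exprn_gt0.
have a_le (b : 'rV[R]_q -> R) : measurable_fun setT b ->
    (forall xi, 0 <= b xi <= 1) -> 0 <= a b <= m.
  move=> mb b01; rewrite a_ge0//=.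
  have mfg : measurable_fun setT (fun xi => f (gamma, xi)).
    exact: (measurableT_comp mf (pair1_measurable gamma)).
  have i1 : (lebesgue_rV q).-integrable setT
      (EFin \o (fun xi => cst 1 xi * f (gamma, xi))).
    apply/integrableP; split.
      by apply/measurable_EFinP; exact: measurable_funM.
    rewrite (eq_integral (fun xi => (f (gamma, xi))%:E))// => xi _ /=.
    by rewrite mul1r ger0_norm.
  apply: le_Rintegral => //.
    apply: le_integrable i1 => //.
      by apply/measurable_EFinP; exact: measurable_funM.
    move=> xi _ /=; rewrite lee_fin mul1r normrM ler_piMl//.
    by case/andP: (b01 xi) => *; rewrite ger0_norm.
  by move=> xi _; rewrite mul1r ler_piMl//; case/andP: (b01 xi).
have H1 := kernel_average_consistent k0 (measurable_cst (1 : R)) c01.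
have Hphi := kernel_average_consistent k0 mphi phi01.
have Hphi2 := kernel_average_consistent k0 mphi2 phi2.
apply: whp_sub (whp_and H1 (whp_and Hphi Hphi2)).
near=> n => o [x1 [y1 z1]].
have n0 : (0 < n)%N by near: n; exact: nbhs_infty_gt.
have nh : 0 < n%:R * h n ^+ p by rewrite mulr_gt0 ?ltr0n// exprn_gt0.
have wb0 := NW_weight_gt0 gamma (h n) (fun i : 'I_n => S i o) n0.
have wb1 := NW_weight_sum gamma (h n) (fun i : 'I_n => S i o) n0.
have vE : NW_variance gamma (h n) (fun i : 'I_n => S i o) phi =
    kernel_average (fun xi => phi xi ^+ 2) n o / kernel_average (cst 1) n o -
    (kernel_average phi n o / kernel_average (cst 1) n o) ^+ 2.
  rewrite -!NW_expectationE//.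
  exact: (wvarE (fun i : 'I_n => phi (S i o).2) wb1).
have v0 : 0 <= NW_variance gamma (h n) (fun i : 'I_n => S i o) phi.
  apply: (wvar_ge0 (fun i : 'I_n => phi (S i o).2)) => i; exact: ltW.
have y01 : 0 <= kernel_average phi n o <= kernel_average (cst 1) n o.
  have psi0 (b : 'rV[R]_q -> R) z : 0 <= b z.2 -> 0 <= psi (h n) b z.
    by move=> b0; rewrite mulr_ge0// ltW// NW_kernel_gt0.
  rewrite mulr_ge0 ?invr_ge0 ?(ltW nh)//=; last first.
    by apply: sumr_ge0 => i _; apply: psi0; case/andP: (phi01 (S i o).2).
  rewrite ler_pM2l ?invr_gt0//; apply: ler_sum => i _.
  rewrite ler_pM2l ?NW_kernel_gt0//; by case/andP: (phi01 (S i o).2).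
have := ratio_variance_close m_gt0 (exprn_gt0 2 t0) (a_le _ mphi phi01)
  (a_le _ mphi2 phi2) y01 x1 y1 z1.
rewrite -vE -cond_varianceE// => vv.
have st : 0 <= Num.sqrt (NW_variance gamma (h n) (fun i : 'I_n => S i o) phi) + t.
  by rewrite addr_ge0 ?sqrtr_ge0// ltW.
rewrite -[leRHS]ger0_norm// -sqrtr_sqr ler_wsqrtr// (le_trans vv)//.
rewrite sqrrD sqr_sqrtr// lerD2r lerDl mulrn_wge0// mulr_ge0 ?sqrtr_ge0//.
exact: ltW.
Unshelve. all: by end_near. Qed.

End nadaraya_watson_consistency.

(** * Exact variance regularization *)

Section clipping.
Context {R : realType} {p q : nat}.

(* (A1) bounds the loss on the support of [xi~] only. *)
Definition clip01 (phi : 'rV[R]_q -> R) xi : R :=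
  Num.max 0 (Num.min (phi xi) 1).

Lemma clip01_itv phi xi : 0 <= clip01 phi xi <= 1.
Proof. by rewrite /clip01 le_max lexx/= ge_max ler01 ge_min lexx orbT. Qed.

Lemma clip01_id phi xi : 0 <= phi xi <= 1 -> clip01 phi xi = phi xi.
Proof. by move=> /andP[x0 x1]; rewrite /clip01 min_l// max_r. Qed.

Lemma measurable_clip01 (phi : 'rV[R]_q -> R) : measurable_fun setT phi ->
  measurable_fun setT (clip01 phi).
Proof.
by move=> mphi; apply: measurable_maxr => //; exact: measurable_minr.
Qed.

Lemma cond_variance_clip01 (f : 'rV[R]_p * 'rV[R]_q -> R) gamma
    (Xi : set 'rV[R]_q) (phi : 'rV[R]_q -> R) :
  (forall xi, ~ Xi xi -> f (gamma, xi) = 0) ->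
  (forall xi, Xi xi -> 0 <= phi xi <= 1) ->
  cond_variance f gamma (clip01 phi) = cond_variance f gamma phi.
Proof.
move=> fXi phi01.
have ce : cond_expectation f gamma (clip01 phi) = cond_expectation f gamma phi.
  apply: eq_Rintegral => xi _; have [/phi01 x01|/fXi ->] := pselect (Xi xi).
    by rewrite clip01_id.
  by rewrite mul0r !mulr0.
rewrite /cond_variance ce; apply: eq_Rintegral => xi _.
have [/phi01 x01|/fXi ->] := pselect (Xi xi); first by rewrite clip01_id.
by rewrite mul0r !mulr0.
Qed.

End clipping.

(** Each observation leaves [Xi] with probability 0, and there are countably many, so a single null
    set serves all sample sizes. *)
Lemma data_off_support_null (R : realType) (p q : nat) d
    (Omega : measurableType d) (P : probability Omega R)
    (V : {RV P >-> ('rV[R]_p * 'rV[R]_q)%type})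
    (S : nat -> {RV P >-> ('rV[R]_p * 'rV[R]_q)%type})
    (f : 'rV[R]_p * 'rV[R]_q -> R) (Xi : set 'rV[R]_q) :
  has_density (distribution P V) f ->
  (forall i, identically_distributed (S i) V) -> measurable Xi ->
  (forall u xi, ~ Xi xi -> f (u, xi) = 0) ->
  exists N, [/\ measurable N, P N = 0%E &
    forall o, ~ N o -> forall i, Xi (S i o).2].
Proof.
move=> [_ _ fE] hident mXi fXi.
pose A : set ('rV[R]_p * 'rV[R]_q) := snd @^-1` (~` Xi).
have mA : measurable A.
  rewrite -[A]setTI; apply: (measurable_snd (T1 := 'rV[R]_p)) => //.
  exact: measurableC.
have mSA i : measurable (S i @^-1` A).
  by rewrite -[X in measurable X]setTI; exact: (measurable_funP (S i)).
exists (\bigcup_i (S i @^-1` A)); split.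
- exact: bigcup_measurable.
- apply/eqP; rewrite -measure_le0.
  apply: (le_trans (measure_sigma_subadditive P mSA _ _)).
  + exact: bigcup_measurable.
  + by [].
  rewrite eseries0// => i _ _.
  rewrite -[LHS]/(distribution P (S i) A) (hident i)// fE//.
  by rewrite integral0_eq// => -[u xi] /= nXi; rewrite fXi.
- move=> o No i; apply: contrapT => nXi; apply: No.
  by exists i.
Qed.

Theorem proposition6 (R : realType) (p q d : nat)
    (dO : measure_display) (Omega : measurableType dO)
    (P : probability Omega R)
    (* the random vector (gamma~, xi~), its density, and the data *)
    (V : {RV P >-> ('rV[R]_p * 'rV[R]_q)%type})
    (f : 'rV[R]_p * 'rV[R]_q -> R)
    (S : nat -> {RV P >-> ('rV[R]_p * 'rV[R]_q)%type})
    (hf : has_density (distribution P V) f)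
    (hindep : mutually_independent P S)
    (hident : forall i, identically_distributed (S i) V)
    (gamma : 'rV[R]_p) (X : set 'rV[R]_d) (ell : 'rV[R]_d -> 'rV[R]_q -> R)
    (Xi : set 'rV[R]_q)
    (hXi : Xi = topological_support (pushforward P (fun o => (V o).2)))
    (hell : forall x, X x -> measurable_fun setT (ell x))
    (* (A1) *)
    (hXi_compact : compact Xi)
    (hell01 : forall x xi, X x -> Xi xi -> 0 <= ell x xi <= 1)
    (* (A2) *)
    (hf2 : twice_differentiable_bounded f)
    (hgamma : marginal_density f gamma != 0)
    (* (A3) *)
    (h : nat -> R) (hpos : forall n, 0 < h n)
    (h0 : h @ \oo --> 0)
    (hinf : (fun n => n%:R * h n ^+ p) @ \oo --> +oo)
    (* convexity, boundedness, Lipschitz continuity *)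
    (hconv : forall xi, Xi xi -> convex_function X (ell ^~ xi))
    (hX : bounded_set X)
    (M : R) (hM : 0 <= M)
    (hLip : forall x x' xi, X x -> X x' -> Xi xi ->
      `|ell x xi - ell x' xi| <= M * enorm (x - x'))
    (Clambda tau eta delta : R)
    (hC : 0 < Clambda) (htau : 0 < tau) (heta : 0 < eta)
    (hdelta : 0 < delta < 1)
    (* the eta-net *)
    (Xeta : {fset 'rV[R]_d})
    (hXeta : forall x, x \in Xeta -> X x)
    (hnet : forall x, X x -> exists2 x', x' \in Xeta & enorm (x - x') <= eta)
    (c : R) (hcard : (#|` Xeta|)%:R <= c * (diameter X / eta) ^+ d) :
  let g := scaled_marginal_density f gamma in
  let data n (o : Omega) (i : 'I_n) := S i o in
  let lambda n := Clambda / Num.sqrt (n%:R * h n ^+ p * g) in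
  exists eps : nat -> R,
    [/\ eps @ \oo --> 0, forall n, 0 < 1 + eps n &
    forall n, (0 < n)%N ->
      (forall x, X x ->
        Clambda / Num.sqrt (n%:R * h n ^+ p * g) + tau +
        Num.sqrt ((ln ((#|` Xeta|)%:R / delta) + ln (1 + 2 / tau)) /
                  (n%:R * h n ^+ p * g * (1 + eps n))) +
        2 * M * eta <= Num.sqrt (cond_variance f gamma (ell x))) ->
      exists E : set Omega,
        [/\ measurable E, ((1 - delta)%:E <= P E)%E &
        forall o, E o -> forall x, X x ->
          is_max
            [set (\int[Q]_xi (ell x xi)%:E)%E |
               Q in ambiguity_set gamma (h n) (data n o) (lambda n)]
            (NW_expectation gamma (h n) (data n o) (ell x) +
             lambda n *
             Num.sqrt (NW_variance gamma (h n) (data n o) (ell x)))%:E]].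
Proof.
move=> g data lambda.
have [f0 mf fE] := hf.
have cf := density_continuous hf2.
have [L L0 fL] := density_lipschitz hf2.
(* A null open neighbourhood of a point off the support misses the support entirely. *)
have oXiC : open (~` Xi).
  rewrite openE => xi; rewrite hXi.
  move=> /existsNP[U /not_implyP[oU /not_implyP[Uxi PU]]].
  apply: (filterS _ (open_nbhs_nbhs (conj oU Uxi))) => y Uy Xiy.
  exact: PU (Xiy U oU Uy).
have mXi : measurable Xi.
  by rewrite -[Xi]setCK; apply: measurableC; exact: measurable_rV_open.
have Xioo : (lebesgue_rV q Xi < +oo)%E.
  have [B [_ HB]] := compact_bounded hXi_compact.
  pose b := Num.max B 0 + 1.
  have b0 : 0 < b by rewrite ltr_wpDl// le_max lexx orbT.
  have bB : B < b by rewrite ltr_pwDr// le_max lexx.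
  have sub : Xi `<=` ball 0 (b + 1).
    move=> xi Xixi; rewrite mx_norm_ball /ball_/= sub0r normrN.
    by apply: le_lt_trans (HB _ bB _ Xixi) _; rewrite ltrDl.
  apply: (@le_lt_trans _ _ (lebesgue_rV q (ball 0%R (b + 1)%R))).
    apply: le_measure; rewrite ?inE//.
    by apply: measurable_rV_ball; rewrite addr_gt0.
  by rewrite lebesgue_rV_ball ?ltry// addr_gt0.
have fXi u xi : ~ Xi xi -> f (u, xi) = 0.
  by rewrite hXi; exact: density_eq0_off_support.
have foo : (\int[lebesgue_rV q]_xi (f (gamma, xi))%:E < +oo)%E.
  (* [fine] sends an infinite integral to 0 *)
  rewrite ltey; apply: contraNneq hgamma => foo.
  by rewrite /marginal_density /Rintegral foo.
have [N0 [mN0 PN0 N0Xi]] := data_off_support_null hf hident mXi fXi.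
have vclip x : X x -> cond_variance f gamma (clip01 (ell x)) =
    cond_variance f gamma (ell x).
  move=> Xx; apply: cond_variance_clip01 => [xi|xi]; first exact: fXi.
  exact: hell01.
have data01 o n x : ~ N0 o -> X x ->
    forall i : 'I_n, 0 <= ell x (data n o i).2 <= 1.
  by move=> No Xx i; apply: hell01 => //; exact: N0Xi.
have NWclip o n x : ~ N0 o -> X x ->
    NW_variance gamma (h n) (data n o) (clip01 (ell x)) =
    NW_variance gamma (h n) (data n o) (ell x).
  move=> No Xx; have e i := clip01_id (data01 o n x No Xx i).
  have eE : NW_expectation gamma (h n) (data n o) (clip01 (ell x)) =
      NW_expectation gamma (h n) (data n o) (ell x).
    by apply: eq_bigr => i _; rewrite e.
  by apply: eq_bigr => i _; rewrite e eE.
have lambda0 n : 0 <= lambda n by rewrite divr_ge0 ?sqrtr_ge0// ltW.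
have maxE o n x : (0 < n)%N -> ~ N0 o -> X x ->
    lambda n <= Num.sqrt (NW_variance gamma (h n) (data n o) (ell x)) ->
    is_max [set (\int[Q]_xi (ell x xi)%:E)%E |
        Q in ambiguity_set gamma (h n) (data n o) (lambda n)]
      (NW_expectation gamma (h n) (data n o) (ell x) +
       lambda n * Num.sqrt (NW_variance gamma (h n) (data n o) (ell x)))%:E.
  move=> n0 No Xx ls; apply: robust_expectationE => //.
  - exact: hell.
  - exact: data01.
  - by rewrite lambda0.
(* If [X] is empty the claim is void; otherwise the point [x0] serves to refute the assumed bound at
   bad sample sizes. *)
have [X0|/set0P[x0 Xx0]] := eqVneq X set0.
  exists (cst 0); split => [|n|n n0 _]; [exact: cvg_cst|by rewrite addr0|].
  exists setT; split => //; last by move=> o _ x; rewrite X0.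
  by rewrite probability_setT lee_fin lerBlDr lerDl ltW//; case/andP: hdelta.
(* [good n] depends on the sample size but not on the outcome, so the deterministic sequence [eps]
   can be defined by cases on it. *)
pose good n := exists N, [/\ measurable N, (P N <= delta%:E)%E &
  forall o, ~ N o -> forall x, x \in (Xeta : seq _) ->
    Num.sqrt (cond_variance f gamma (clip01 (ell x))) <=
    Num.sqrt (NW_variance gamma (h n) (data n o) (clip01 (ell x))) + tau].
have good_near : \forall n \near \oo, good n.
  have [d0 _] := andP hdelta.
  apply: (whp_all (P := P) _ d0) => x Xetax.
  apply: (NW_variance_consistent hf hindep hident hpos h0 hinf L0 fL mXi Xioo
    fXi foo hgamma htau).
    by apply: measurable_clip01; apply: hell; exact: hXeta.
  exact: clip01_itv.
pose a n := n%:R * h n ^+ p * g.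
pose l := ln ((#|` Xeta|)%:R / delta) + ln (1 + 2 / tau).
(* The net is nonempty and [delta < 1], so the first logarithm is nonnegative; the second is
   positive. *)
have l0 : 0 < l.
  have [x' Xetax' _] := hnet _ Xx0.
  have [d0 d1] := andP hdelta.
  rewrite /l ltr_wpDl ?ln_gt0 ?ltrDl ?divr_gt0// ln_ge0//.
  rewrite ler_pdivlMr// mul1r (le_trans (ltW d1))// ler1n cardfs_gt0.
  by apply/fset0Pn; exists x'.
pose v := `|cond_variance f gamma (ell x0)| + 1.
have v0 : 0 < v by rewrite ltr_wpDl.
(* In the finitely many bad cases the [o(1)] term is chosen so as to make the
   assumed lower bound on the conditional variance fail at [x0]. *)
pose eps n := if `[< good n >] then 0 else
  if 0 < a n then l / (a n * v) - 1 else 0.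
exists eps; split.
- apply: cvg_near_cst; near=> n; rewrite /eps ifT//.
  by apply/asboolP; near: n.
- move=> n; rewrite /eps; case: ifP => _; first by rewrite addr0.
  by case: ifP => an; rewrite ?addr0// addrC subrK divr_gt0// mulr_gt0.
move=> n n0 hV.
have lambda_small : ~ good n -> lambda n = 0.
  move=> ngood; have [an|an] := ltP 0 (a n); last first.
    (* nonpositive radicand: [sqrt] gives 0 and so does division by it *)
    by rewrite /lambda -/(a n) ler0_sqrtr// invr0 mulr0.
  (* With this [eps n] the third term of the assumed bound is [Num.sqrt v], already larger than the
     standard deviation at [x0]. *)
  exfalso; have := hV x0 Xx0; apply/negP; rewrite -ltNge.
  have -> : 1 + eps n = l / (a n * v).
    rewrite /eps ifF ?an; last by apply/asboolP.
    by rewrite addrC subrK.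
  rewrite -/(a n) -/l (_ : l / (a n * (l / (a n * v))) = v); last first.
    by field; rewrite !gt_eqF.
  apply: (@lt_le_trans _ _ (Num.sqrt v)).
    rewrite ltr_sqrt// (le_lt_trans (ler_norm _))// ltrDl//.
  have := lambda0 n; rewrite /lambda -/(a n) => la.
  by have := mulr_ge0 (mulr_ge0 (ler0n R 2) hM) (ltW heta); lra.
(* At a bad sample size [lambda n] is 0, so any empirical standard deviation is large enough and
   only the null set [N0] is excluded. *)
have [[N [mN PN Ngood]]|ngood] := pselect (good n); last first.
  exists (~` N0); split; first exact: measurableC.
    rewrite probability_setC// PN0 sube0 lee_fin lerBlDr lerDl ltW//.
    by case/andP: hdelta.
  by move=> o No x Xx; apply: maxE => //; rewrite lambda_small ?sqrtr_ge0.
exists (~` (N `|` N0)); split.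
- by apply: measurableC; exact: measurableU.
- rewrite probability_setC; last exact: measurableU.
  rewrite EFinB leeB//; apply: le_trans (measureU2 P mN mN0) _.
  by rewrite [X in (_ + X)%E]PN0 adde0.
move=> o /not_orP[No N0o] x Xx; apply: maxE => //.
(* Passing from the true deviation at [x'] to the empirical one costs [tau], and moving from [x'] to
   [x] costs [M * eta]; the assumed bound at [x'] covers both and leaves [lambda n]. *)
have [x' Xetax' xx'] := hnet _ Xx.
have Xx' := hXeta _ Xetax'.
have := Ngood o No x' Xetax'; rewrite vclip// NWclip// => Vx'.
have close i : `|ell x' (data n o i).2 - ell x (data n o i).2| <= M * eta.
  rewrite distrC (le_trans (hLip _ _ _ Xx Xx' (N0Xi _ N0o _)))//.
  by rewrite ler_wpM2l.
have wb0 i := ltW (NW_weight_gt0 gamma (h n) (data n o) n0 i).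
have := sqrt_wvar_lipschitz wb0 (NW_weight_sum gamma (h n) (data n o) n0)
  close (mulr_ge0 hM (ltW heta)).
rewrite -!/(NW_variance gamma (h n) (data n o) _) => Vxx'.
have := hV x' Xx'; rewrite -/(lambda n) => hVx'.
have := sqrtr_ge0 (l / (a n * (1 + eps n))); rewrite /l /a => s0.
have := mulr_ge0 hM (ltW heta).
lra.
Unshelve. all: by end_near. Qed.
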